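(* Let $\mathfrak{A}$ be an abelian category such that $D^b(\mathfrak{A})$ has an almost split triangle $X^\bullet\to Y^\bullet\to Z^\bullet\to X^\bullet[1]$. (1) If $\mathfrak{A}$ has enough projective objects, then $Z^\bullet$ has a finite projective resolution. (2) If $\mathfrak{A}$ has enough injective objects, then $X^\bullet$ has a finite injective co-resolution.
   Context: $D^b(\mathfrak{A})$ is the bounded derived category, whose objects are the bounded (cochain) complexes over $\mathfrak{A}$. A finite projective resolution of a complex $Z^\bullet$ is a quasi-isomorphism $P^\bullet\to Z^\bullet$ with $P^\bullet$ a bounded complex of projective objects; a finite injective co-resolution of $X^\bullet$ is a quasi-isomorphism $X^\bullet\to I^\bullet$ with $I^\bullet$ a bounded complex of injective objects. In a triangulated category, an exact triangle $X\xrightarrow{f}Y\xrightarrow{g}Z\to X[1]$ is almost split if $f$ is minimal left almost split and $g$ is minimal right almost split. Here $f:X\to Y$ is left minimal if every $h:Y\to Y$ with $hf=f$ is an automorphism, left almost split if it is not a section and every non-section $X\to M$ factors through $f$, minimal left almost split if both; the right versions are dual. *)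

(* Defs.v *)
From HB Require Import structures.
From mathcomp Require Import all_boot all_order all_algebra.
From mathcomp Require Import boolp zify.
Set Implicit Arguments.
Unset Strict Implicit.
Unset Printing Implicit Defensive.
Import GRing.Theory.
Local Open Scope ring_scope.
Local Open Scope quotient_scope.

Local Obligation Tactic := idtac.

Declare Scope category_scope.
Delimit Scope category_scope with cat.
Local Open Scope category_scope.

Record category := Category {
  obj :> Type;
  mor : obj -> obj -> Type;
  idm : forall X, mor X X;
  cmp : forall X Y Z, mor Y Z -> mor X Y -> mor X Z;
  cmp1m : forall X Y (f : mor X Y), cmp (idm Y) f = f;
  cmpm1 : forall X Y (f : mor X Y), cmp f (idm X) = f;
  cmpmA : forall X Y Z T (h : mor Z T) (g : mor Y Z) (f : mor X Y),
    cmp h (cmp g f) = cmp (cmp h g) f }.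

Arguments mor {c} X Y.
Arguments idm {c} X.
Arguments cmp {c X Y Z} g f.

Notation "g ∘ f" := (cmp g f)
  (at level 40, left associativity) : category_scope.

Record functor (C D : category) := Functor {
  fobj :> C -> D;
  fmap : forall X Y : C, mor X Y -> mor (fobj X) (fobj Y);
  fmap1 : forall X : C, fmap (idm X) = idm (fobj X);
  fmapM : forall (X Y Z : C) (g : mor Y Z) (f : mor X Y),
    fmap (g ∘ f) = fmap g ∘ fmap f }.

Arguments fmap {C D} F {X Y} f : rename.

Section Morphisms.
Variable C : category.
Implicit Types X Y Z : C.

Definition is_iso X Y (f : mor X Y) : Prop :=
  exists g : mor Y X, g ∘ f = idm X /\ f ∘ g = idm Y.

Definition is_section X Y (f : mor X Y) : Prop :=
  exists r : mor Y X, r ∘ f = idm X.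

Definition is_retraction X Y (f : mor X Y) : Prop :=
  exists s : mor Y X, f ∘ s = idm Y.

Definition is_mono X Y (f : mor X Y) : Prop :=
  forall T (a b : mor T X), f ∘ a = f ∘ b -> a = b.

Definition is_epi X Y (f : mor X Y) : Prop :=
  forall T (a b : mor Y T), a ∘ f = b ∘ f -> a = b.

Definition projective (P : C) : Prop :=
  forall X Y (e : mor X Y), is_epi e ->
  forall f : mor P Y, exists g : mor P X, e ∘ g = f.

Definition injective_obj (I : C) : Prop :=
  forall X Y (m : mor X Y), is_mono m ->
  forall f : mor X I, exists g : mor Y I, g ∘ m = f.

Definition enough_projectives : Prop :=
  forall X, exists (P : C) (e : mor P X), projective P /\ is_epi e.

Definition enough_injectives : Prop :=
  forall X, exists (I : C) (m : mor X I), injective_obj I /\ is_mono m.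

Definition left_minimal X Y (f : mor X Y) : Prop :=
  forall h : mor Y Y, h ∘ f = f -> is_iso h.

Definition right_minimal X Y (f : mor X Y) : Prop :=
  forall h : mor X X, f ∘ h = f -> is_iso h.

Definition left_almost_split X Y (f : mor X Y) : Prop :=
  ~ is_section f /\
  forall M (u : mor X M), ~ is_section u -> exists v : mor Y M, v ∘ f = u.

Definition right_almost_split X Y (f : mor X Y) : Prop :=
  ~ is_retraction f /\
  forall M (u : mor M Y), ~ is_retraction u -> exists v : mor M X, f ∘ v = u.

Definition minimal_left_almost_split X Y (f : mor X Y) : Prop :=
  left_minimal f /\ left_almost_split f.

Definition minimal_right_almost_split X Y (f : mor X Y) : Prop :=
  right_minimal f /\ right_almost_split f.

End Morphisms.

Record preadditive := Preadditive {
  pa_obj : Type;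
  pa_mor : pa_obj -> pa_obj -> zmodType;
  pa_id : forall X, pa_mor X X;
  pa_cmp : forall X Y Z, pa_mor Y Z -> pa_mor X Y -> pa_mor X Z;
  pa_cmp1m : forall X Y (f : pa_mor X Y), pa_cmp (pa_id Y) f = f;
  pa_cmpm1 : forall X Y (f : pa_mor X Y), pa_cmp f (pa_id X) = f;
  pa_cmpmA : forall X Y Z T (h : pa_mor Z T) (g : pa_mor Y Z) (f : pa_mor X Y),
    pa_cmp h (pa_cmp g f) = pa_cmp (pa_cmp h g) f;
  pa_cmpDl : forall X Y Z (g h : pa_mor Y Z) (f : pa_mor X Y),
    pa_cmp (g + h) f = pa_cmp g f + pa_cmp h f;
  pa_cmpDr : forall X Y Z (g : pa_mor Y Z) (f h : pa_mor X Y),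
    pa_cmp g (f + h) = pa_cmp g f + pa_cmp g h }.

Definition cat_of_preadditive (A : preadditive) : category :=
  Category (@pa_cmp1m A) (@pa_cmpm1 A) (@pa_cmpmA A).
Coercion cat_of_preadditive : preadditive >-> category.

Arguments pa_mor {p} X Y.
Arguments pa_id {p} X.
Arguments pa_cmp {p X Y Z} g f.

Notation "g ∙ f" := (pa_cmp g f)
  (at level 40, left associativity) : category_scope.

Section Preadditive.
Variable A : preadditive.
Implicit Types X Y Z T : pa_obj A.

Lemma pa_cmp0m X Y Z (f : pa_mor X Y) : (0 : pa_mor Y Z) ∙ f = 0.
Proof. by apply: (@addrI _ (0 ∙ f)); rewrite -pa_cmpDl !addr0. Qed.

Lemma pa_cmpm0 X Y Z (g : pa_mor Y Z) : g ∙ (0 : pa_mor X Y) = 0.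
Proof. by apply: (@addrI _ (g ∙ 0)); rewrite -pa_cmpDr !addr0. Qed.

Lemma pa_cmpNm X Y Z (g : pa_mor Y Z) (f : pa_mor X Y) : (- g) ∙ f = - (g ∙ f).
Proof. by apply: (@addrI _ (g ∙ f)); rewrite -pa_cmpDl !subrr pa_cmp0m. Qed.

Lemma pa_cmpmN X Y Z (g : pa_mor Y Z) (f : pa_mor X Y) : g ∙ (- f) = - (g ∙ f).
Proof. by apply: (@addrI _ (g ∙ f)); rewrite -pa_cmpDr !subrr pa_cmpm0. Qed.

Definition is_zero_obj X : Prop :=
  (forall Y (f g : pa_mor X Y), f = g) /\ (forall Y (f g : pa_mor Y X), f = g).

Definition is_kernel X Y (f : pa_mor X Y) K (k : pa_mor K X) : Prop :=
  f ∙ k = 0 /\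
  forall T (a : pa_mor T X), f ∙ a = 0 ->
    exists! b : pa_mor T K, k ∙ b = a.

Definition is_cokernel X Y (f : pa_mor X Y) Q (q : pa_mor Y Q) : Prop :=
  q ∙ f = 0 /\
  forall T (a : pa_mor Y T), a ∙ f = 0 ->
    exists! b : pa_mor Q T, b ∙ q = a.

Record biproduct X Y := Biproduct {
  bip : pa_obj A;
  in1 : pa_mor X bip;
  in2 : pa_mor Y bip;
  pr1 : pa_mor bip X;
  pr2 : pa_mor bip Y;
  pr1_in1 : pr1 ∙ in1 = pa_id X;
  pr2_in2 : pr2 ∙ in2 = pa_id Y;
  pr1_in2 : pr1 ∙ in2 = 0;
  pr2_in1 : pr2 ∙ in1 = 0;
  in_pr : in1 ∙ pr1 + in2 ∙ pr2 = pa_id bip }.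

End Preadditive.

(** The biproducts are chosen, so that mapping cones are given by a formula. *)
Record abelian := Abelian {
  ab_preadditive :> preadditive;
  ab_zero : exists Z : pa_obj ab_preadditive, is_zero_obj Z;
  ab_biproduct : forall X Y : pa_obj ab_preadditive, biproduct X Y;
  ab_kernel : forall (X Y : pa_obj ab_preadditive) (f : pa_mor X Y),
    exists (K : pa_obj ab_preadditive) (k : pa_mor K X), is_kernel f k;
  ab_cokernel : forall (X Y : pa_obj ab_preadditive) (f : pa_mor X Y),
    exists (Q : pa_obj ab_preadditive) (q : pa_mor Y Q), is_cokernel f q;
  ab_mono_normal : forall (X Y : pa_obj ab_preadditive) (f : pa_mor X Y),
    @is_mono ab_preadditive X Y f ->
    exists (Z : pa_obj ab_preadditive) (g : pa_mor Y Z), is_kernel g f;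
  ab_epi_conormal : forall (X Y : pa_obj ab_preadditive) (f : pa_mor X Y),
    @is_epi ab_preadditive X Y f ->
    exists (Z : pa_obj ab_preadditive) (g : pa_mor Z X), is_cokernel g f }.

(** In order to avoid transports along [n - 1 + 1 = n], conditions on a complex
    [X] around the degree [n + 1] are expressed with the maps
    [X n -> X (n + 1) -> X (n + 1 + 1)] and quantified over all [n : int]. *)

Section Complexes.
Variable A : abelian.

Record complex := Complex {
  cx : int -> A;
  dif : forall n, pa_mor (cx n) (cx (n + 1));
  dif_dif : forall n, dif (n + 1) ∙ dif n = 0 }.

Definition bounded (X : complex) : Prop :=
  exists N : nat, forall n : int, (N < `|n|)%N -> is_zero_obj (cx X n).

Record bcomplex := BComplex {
  bcx :> complex;
  bcx_bounded : bounded bcx }.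

Record chain_map (X Y : complex) := ChainMap {
  cm : forall n, pa_mor (cx X n) (cx Y n);
  cm_dif : forall n, dif Y n ∙ cm n = cm (n + 1) ∙ dif X n }.

Lemma chain_map_eq X Y (f g : chain_map X Y) :
  (forall n, cm f n = cm g n) -> f = g.
Proof.
case: f g => [f Hf] [g Hg] /= fg.
have {}fg : f = g by apply: functional_extensionality_dep.
by case: g / fg Hg => Hg; rewrite (Prop_irrelevance Hf Hg).
Qed.

Program Definition chain_id (X : complex) : chain_map X X :=
  @ChainMap X X (fun n => pa_id (cx X n)) _.
Next Obligation. by move=> X n; rewrite pa_cmpm1 pa_cmp1m. Qed.

Program Definition chain_cmp (X Y Z : complex)
    (g : chain_map Y Z) (f : chain_map X Y) : chain_map X Z :=
  @ChainMap X Z (fun n => cm g n ∙ cm f n) _.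
Next Obligation.
by move=> X Y Z g f n; rewrite pa_cmpmA cm_dif -pa_cmpmA cm_dif pa_cmpmA.
Qed.

Program Definition Cb : category :=
  @Category bcomplex (fun X Y => chain_map X Y) (fun X => chain_id X)
    (fun X Y Z => @chain_cmp X Y Z) _ _ _.
Next Obligation. by move=> X Y f; apply: chain_map_eq => n; apply: pa_cmp1m. Qed.
Next Obligation. by move=> X Y f; apply: chain_map_eq => n; apply: pa_cmpm1. Qed.
Next Obligation.
by move=> X Y Z T h g f; apply: chain_map_eq => n; apply: pa_cmpmA.
Qed.

(** [cohomology X n] is a presentation of the cohomology of [X] in degree
    [n + 1]: a kernel [cyc] of [X (n + 1) -> X (n + 1 + 1)] and a cokernel [coh]
    of the induced map [X n -> cyc]. It exists and is unique up to unique
    isomorphism. *)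
Record cohomology (X : complex) (n : int) := Cohomology {
  cyc : A;
  cyc_in : pa_mor cyc (cx X (n + 1));
  cyc_kernel : is_kernel (dif X (n + 1)) cyc_in;
  bnd : pa_mor (cx X n) cyc;
  cyc_in_bnd : cyc_in ∙ bnd = dif X n;
  coh : A;
  coh_pr : pa_mor cyc coh;
  coh_cokernel : is_cokernel bnd coh_pr }.

Definition cohomology_map (X Y : complex) (f : chain_map X Y) n
    (HX : cohomology X n) (HY : cohomology Y n)
    (h : pa_mor (coh HX) (coh HY)) : Prop :=
  exists z : pa_mor (cyc HX) (cyc HY),
    cyc_in HY ∙ z = cm f (n + 1) ∙ cyc_in HX /\ h ∙ coh_pr HX = coh_pr HY ∙ z.

Definition quasi_iso (X Y : complex) (f : chain_map X Y) : Prop :=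
  forall n (HX : cohomology X n) (HY : cohomology Y n)
    (h : pa_mor (coh HX) (coh HY)), cohomology_map f h ->
    @is_iso A _ _ h.

Lemma cohomology_exists (X : complex) n : inhabited (cohomology X n).
Proof.
have [K [k kK]] := ab_kernel (dif X (n + 1)).
have [b [bE _]] := kK.2 _ (dif X n) (dif_dif X n).
have [Q [q qQ]] := ab_cokernel b.
by constructor; exact: (Cohomology kK bE qQ).
Qed.

Lemma cohomology_map_exists (X Y : complex) (f : chain_map X Y) n
    (HX : cohomology X n) (HY : cohomology Y n) :
  exists! h : pa_mor (coh HX) (coh HY), cohomology_map f h.
Proof.
have [kX0 _] := cyc_kernel HX; have [kY0 kY] := cyc_kernel HY.
have [qX0 qX] := coh_cokernel HX; have [qY0 _] := coh_cokernel HY.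
have [|z [zE zU]] := kY _ (cm f (n + 1) ∙ cyc_in HX).
  by rewrite pa_cmpmA cm_dif -pa_cmpmA kX0 pa_cmpm0.
have zb : z ∙ bnd HX = bnd HY ∙ cm f n.
  have [|b [_ bU]] := kY _ (dif Y n ∙ cm f n).
    by rewrite pa_cmpmA dif_dif pa_cmp0m.
  rewrite -(bU (z ∙ bnd HX)) ?(bU (bnd HY ∙ cm f n)) //.
    by rewrite pa_cmpmA cyc_in_bnd.
  by rewrite pa_cmpmA zE -pa_cmpmA cyc_in_bnd cm_dif.
have [|h [hE hU]] := qX _ (coh_pr HY ∙ z).
  by rewrite -pa_cmpmA zb pa_cmpmA qY0 pa_cmp0m.
exists h; split; first by exists z.
by move=> h' [z' [z'E h'E]]; apply: hU; rewrite h'E (zU _ z'E).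
Qed.

Program Definition cx_shift (X : complex) : complex :=
  @Complex (fun n => cx X (n + 1)) (fun n => - dif X (n + 1)) _.
Next Obligation. by move=> X n; rewrite pa_cmpNm pa_cmpmN dif_dif !oppr0. Qed.

Lemma bounded_shift (X : complex) : bounded X -> bounded (cx_shift X).
Proof.
move=> [N HN]; exists N.+1 => n ltNn; apply: HN.
by move: ltNn; lia.
Qed.

Program Definition shift_map (X Y : complex) (f : chain_map X Y) :
    chain_map (cx_shift X) (cx_shift Y) :=
  @ChainMap (cx_shift X) (cx_shift Y) (fun n => cm f (n + 1)) _.
Next Obligation. by move=> X Y f n /=; rewrite pa_cmpNm pa_cmpmN cm_dif. Qed.

Definition bshift (X : bcomplex) : bcomplex :=
  BComplex (bounded_shift (bcx_bounded X)).

Program Definition Cb_shift : functor Cb Cb :=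
  @Functor Cb Cb bshift (fun X Y f => shift_map f) _ _.
Next Obligation. by move=> X; apply: chain_map_eq. Qed.
Next Obligation. by move=> X Y Z g f; apply: chain_map_eq. Qed.

Definition shift_cohomology (X : complex) n (H : cohomology (cx_shift X) n) :
  cohomology X (n + 1).
Proof.
case: H => K k kK b bE Q q qQ.
apply: (@Cohomology X (n + 1) K k _ (- b) _ Q q).
- case: kK => /= kd kU; split.
    by apply: oppr_inj; rewrite -pa_cmpNm oppr0.
  by move=> T a a0; apply: kU; rewrite pa_cmpNm a0 oppr0.
- by rewrite pa_cmpmN bE /= opprK.
- case: qQ => qb qU; split; first by rewrite pa_cmpmN qb oppr0.
  move=> T a a0; apply: qU.
  by apply: oppr_inj; rewrite -pa_cmpmN oppr0.
Defined.

Lemma quasi_iso_shift (X Y : complex) (f : chain_map X Y) :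
  quasi_iso f -> quasi_iso (shift_map f).
Proof.
move=> qf n HX HY; move: (qf (n + 1) (shift_cohomology HX) (shift_cohomology HY)).
case: HX => ? ? ? ? ? ? ? ?; case: HY => ? ? ? ? ? ? ? ? H h hf.
exact: (H h hf).
Qed.

Section Cone.
Variables (X Y : complex) (u : chain_map X Y).

Let C n := ab_biproduct (cx X (n + 1)) (cx Y n).

Definition cone_dif n : pa_mor (bip (C n)) (bip (C (n + 1))) :=
  in1 (C (n + 1)) ∙ (- dif X (n + 1)) ∙ pr1 (C n)
  + in2 (C (n + 1)) ∙ cm u (n + 1) ∙ pr1 (C n)
  + in2 (C (n + 1)) ∙ dif Y n ∙ pr2 (C n).

Lemma pr1_cone_dif n :
  pr1 (C (n + 1)) ∙ cone_dif n = - dif X (n + 1) ∙ pr1 (C n).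
Proof.
rewrite /cone_dif !pa_cmpDr !pa_cmpmA pr1_in1 !pr1_in2 !pa_cmp0m !addr0.
by rewrite pa_cmp1m.
Qed.

Lemma pr2_cone_dif n :
  pr2 (C (n + 1)) ∙ cone_dif n = cm u (n + 1) ∙ pr1 (C n) + dif Y n ∙ pr2 (C n).
Proof.
rewrite /cone_dif !pa_cmpDr !pa_cmpmA pr2_in1 !pr2_in2 !pa_cmp0m add0r.
by rewrite !pa_cmp1m.
Qed.

Lemma cone_dif_in2 n : cone_dif n ∙ in2 (C n) = in2 (C (n + 1)) ∙ dif Y n.
Proof.
rewrite /cone_dif !pa_cmpDl -!pa_cmpmA pr1_in2 pr2_in2 !pa_cmpm0 !add0r.
by rewrite pa_cmpm1.
Qed.

Program Definition cone : complex := @Complex (fun n => bip (C n)) cone_dif _.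
Next Obligation.
move=> n; rewrite {1}/cone_dif !pa_cmpDl -!pa_cmpmA pr1_cone_dif pr2_cone_dif.
have dX : - dif X (n + 1 + 1) ∙ (- dif X (n + 1) ∙ pr1 (C n)) = 0.
  by rewrite pa_cmpmA pa_cmpNm pa_cmpmN dif_dif !oppr0 pa_cmp0m.
have dY : dif Y (n + 1) ∙ (dif Y n ∙ pr2 (C n)) = 0.
  by rewrite pa_cmpmA dif_dif pa_cmp0m.
rewrite dX (pa_cmpDr (dif Y (n + 1))) dY pa_cmpm0 add0r addr0 -pa_cmpDr.
by rewrite pa_cmpNm pa_cmpmN !pa_cmpmA cm_dif addNr pa_cmpm0.
Qed.

Program Definition cone_in : chain_map Y cone :=
  @ChainMap Y cone (fun n => in2 (C n)) _.
Next Obligation. by move=> n; rewrite cone_dif_in2. Qed.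

Program Definition cone_pr : chain_map cone (cx_shift X) :=
  @ChainMap cone (cx_shift X) (fun n => pr1 (C n)) _.
Next Obligation. by move=> n; rewrite pr1_cone_dif. Qed.

Lemma is_zero_bip (V W : pa_obj A) (B : biproduct V W) :
  is_zero_obj V -> is_zero_obj W -> is_zero_obj (bip B).
Proof.
move=> [V1 V2] [W1 W2].
have B0 : pa_id (bip B) = 0.
  rewrite -in_pr (V2 _ (pr1 B) 0) (W2 _ (pr2 B) 0).
  by rewrite !pa_cmpm0 addr0.
split=> T f g.
  by rewrite -(pa_cmpm1 f) -(pa_cmpm1 g) B0 !pa_cmpm0.
by rewrite -(pa_cmp1m f) -(pa_cmp1m g) B0 !pa_cmp0m.
Qed.

Lemma bounded_cone : bounded X -> bounded Y -> bounded cone.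
Proof.
move=> /bounded_shift [N HN] [M HM]; exists (maxn N M) => n.
rewrite gtn_max => /andP[ltNn ltMn].
by apply: is_zero_bip; [apply: HN | apply: HM].
Qed.

End Cone.

Definition bcone (X Y : bcomplex) (u : chain_map X Y) : bcomplex :=
  BComplex (bounded_cone u (bcx_bounded X) (bcx_bounded Y)).

End Complexes.

(** The Gabriel-Zisman localization by generators and relations: morphisms are
    formal composites of morphisms of [C] and of formal inverses of morphisms in
    [W], modulo the least congruence which makes [C -> C[W^-1]] a functor and the
    formal inverses inverses. *)

Section Localization.
Variables (C : category) (W : forall X Y : C, mor X Y -> Prop).

Inductive loc_expr : C -> C -> Type :=
| LMor X Y (f : mor X Y) : loc_expr X Y
| LInv X Y (s : mor X Y) (Ws : W s) : loc_expr Y X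
| LCmp X Y Z (g : loc_expr Y Z) (f : loc_expr X Y) : loc_expr X Z.

Inductive loc_eq : forall X Y, loc_expr X Y -> loc_expr X Y -> Prop :=
| loc_eq_refl X Y (e : loc_expr X Y) : loc_eq e e
| loc_eq_sym X Y (e1 e2 : loc_expr X Y) : loc_eq e1 e2 -> loc_eq e2 e1
| loc_eq_trans X Y (e1 e2 e3 : loc_expr X Y) :
    loc_eq e1 e2 -> loc_eq e2 e3 -> loc_eq e1 e3
| loc_eq_cmp X Y Z (g1 g2 : loc_expr Y Z) (f1 f2 : loc_expr X Y) :
    loc_eq g1 g2 -> loc_eq f1 f2 -> loc_eq (LCmp g1 f1) (LCmp g2 f2)
| loc_eq_1m X Y (e : loc_expr X Y) : loc_eq (LCmp (LMor (idm Y)) e) e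
| loc_eq_m1 X Y (e : loc_expr X Y) : loc_eq (LCmp e (LMor (idm X))) e
| loc_eq_mA X Y Z T (e3 : loc_expr Z T) (e2 : loc_expr Y Z)
    (e1 : loc_expr X Y) :
    loc_eq (LCmp e3 (LCmp e2 e1)) (LCmp (LCmp e3 e2) e1)
| loc_eq_mor X Y Z (g : mor Y Z) (f : mor X Y) :
    loc_eq (LMor (g ∘ f)) (LCmp (LMor g) (LMor f))
| loc_eq_Vm X Y (s : mor X Y) (Ws : W s) :
    loc_eq (LCmp (LInv Ws) (LMor s)) (LMor (idm X))
| loc_eq_mV X Y (s : mor X Y) (Ws : W s) :
    loc_eq (LCmp (LMor s) (LInv Ws)) (LMor (idm Y)).

HB.instance Definition _ X Y := gen_eqMixin (loc_expr X Y).
HB.instance Definition _ X Y := gen_choiceMixin (loc_expr X Y).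

Definition loc_eqb X Y (e1 e2 : loc_expr X Y) : bool := `[< loc_eq e1 e2 >].

Lemma loc_eqb_refl X Y : reflexive (@loc_eqb X Y).
Proof. by move=> e; apply/asboolP; apply: loc_eq_refl. Qed.

Lemma loc_eqb_sym X Y : symmetric (@loc_eqb X Y).
Proof. by move=> e1 e2; apply/asboolP/asboolP; apply: loc_eq_sym. Qed.

Lemma loc_eqb_trans X Y : transitive (@loc_eqb X Y).
Proof.
move=> e2 e1 e3 /asboolP H1 /asboolP H2; apply/asboolP.
exact: loc_eq_trans H1 H2.
Qed.

Canonical loc_equiv X Y :=
  EquivRel (@loc_eqb X Y)
    (@loc_eqb_refl X Y) (@loc_eqb_sym X Y) (@loc_eqb_trans X Y).

Definition loc_mor X Y : Type := {eq_quot (loc_equiv X Y)}.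

Definition loc_class X Y (e : loc_expr X Y) : loc_mor X Y :=
  \pi_({eq_quot (loc_equiv X Y)}) e.

Definition loc_repr X Y (m : loc_mor X Y) : loc_expr X Y :=
  repr (m : {eq_quot (loc_equiv X Y)}).

Lemma loc_reprK X Y (m : loc_mor X Y) : loc_class (loc_repr m) = m.
Proof. exact: reprK. Qed.

Lemma loc_classP X Y (e1 e2 : loc_expr X Y) :
  loc_class e1 = loc_class e2 <-> loc_eq e1 e2.
Proof.
split=> [/eqmodP/asboolP // | H]; by apply/eqmodP/asboolP.
Qed.

Lemma loc_repr_class X Y (e : loc_expr X Y) :
  loc_eq (loc_repr (loc_class e)) e.
Proof. by apply/loc_classP; rewrite loc_reprK. Qed.

Program Definition localization : category :=
  @Category C loc_mor (fun X => loc_class (LMor (idm X)))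
    (fun X Y Z g f => loc_class (LCmp (loc_repr g) (loc_repr f))) _ _ _.
Next Obligation.
move=> X Y f; rewrite -[RHS]loc_reprK; apply/loc_classP.
apply: loc_eq_trans (loc_eq_1m _); apply: loc_eq_cmp (loc_eq_refl _).
exact: loc_repr_class.
Qed.
Next Obligation.
move=> X Y f; rewrite -[RHS]loc_reprK; apply/loc_classP.
apply: loc_eq_trans (loc_eq_m1 _); apply: loc_eq_cmp (loc_eq_refl _) _.
exact: loc_repr_class.
Qed.
Next Obligation.
move=> X Y Z T h g f; apply/loc_classP.
apply: loc_eq_trans (loc_eq_cmp (loc_eq_refl _) (loc_repr_class _)) _.
apply: loc_eq_trans (loc_eq_mA _ _ _) _.
exact: loc_eq_cmp (loc_eq_sym (loc_repr_class _)) (loc_eq_refl _).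
Qed.

Program Definition loc_functor : functor C localization :=
  @Functor C localization id (fun X Y f => loc_class (LMor f)) _ _.
Next Obligation. by []. Qed.
Next Obligation.
move=> X Y Z g f; apply/loc_classP; apply: loc_eq_trans (loc_eq_mor _ _) _.
by apply: loc_eq_cmp; apply: loc_eq_sym; apply: loc_repr_class.
Qed.

Section LocalizationMap.
Variable F : functor C C.
Hypothesis WF : forall (X Y : C) (s : mor X Y), W s -> W (fmap F s).

Fixpoint loc_expr_map X Y (e : loc_expr X Y) : loc_expr (F X) (F Y) :=
  match e with
  | LMor _ _ f => LMor (fmap F f)
  | LInv _ _ _ Ws => LInv (WF Ws)
  | LCmp _ _ _ g f => LCmp (loc_expr_map g) (loc_expr_map f)
  end.

Lemma loc_eq_map X Y (e1 e2 : loc_expr X Y) :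
  loc_eq e1 e2 -> loc_eq (loc_expr_map e1) (loc_expr_map e2).
Proof.
elim=> {X Y e1 e2} /= *; rewrite ?fmap1 ?fmapM.
- exact: loc_eq_refl.
- exact: loc_eq_sym.
- by apply: loc_eq_trans; eassumption.
- exact: loc_eq_cmp.
- exact: loc_eq_1m.
- exact: loc_eq_m1.
- exact: loc_eq_mA.
- exact: loc_eq_mor.
- exact: loc_eq_Vm.
- exact: loc_eq_mV.
Qed.

Program Definition localization_map : functor localization localization :=
  @Functor localization localization F
    (fun X Y f => loc_class (loc_expr_map (loc_repr f))) _ _.
Next Obligation.
move=> X; apply/loc_classP.
apply: loc_eq_trans (loc_eq_map (loc_repr_class _)) _ => /=.
by rewrite fmap1; apply: loc_eq_refl.
Qed.
Next Obligation.
move=> X Y Z g f; apply/loc_classP.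
apply: loc_eq_trans (loc_eq_map (loc_repr_class _)) _ => /=.
by apply: loc_eq_cmp; apply: loc_eq_sym; apply: loc_repr_class.
Qed.

End LocalizationMap.

End Localization.

Section DerivedCategory.
Variable A : abelian.

Definition Cb_quasi_iso (X Y : Cb A) (s : mor X Y) : Prop := quasi_iso s.

Definition Db : category := localization Cb_quasi_iso.

Definition toDb : functor (Cb A) Db := loc_functor Cb_quasi_iso.

Lemma Cb_quasi_iso_shift (X Y : Cb A) (s : mor X Y) :
  Cb_quasi_iso s -> Cb_quasi_iso (fmap (Cb_shift A) s).
Proof. exact: quasi_iso_shift. Qed.

Definition Db_shift : functor Db Db := localization_map Cb_quasi_iso_shift.

(** Exact triangles are the triangles isomorphic in [Db] to
    [U -> V -> cone u -> U[1]] for a morphism of complexes [u : U -> V]. *)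
Definition exact_triangle (X Y Z : Db)
    (f : mor X Y) (g : mor Y Z) (h : mor Z (Db_shift X)) : Prop :=
  exists (U V : bcomplex A) (u : chain_map U V)
    (a : @mor Db X U) (b : @mor Db Y V) (c : @mor Db Z (bcone u)),
  [/\ is_iso a, is_iso b & is_iso c] /\
  [/\ b ∘ f = @fmap _ _ toDb U V u ∘ a,
      c ∘ g = @fmap _ _ toDb V (bcone u) (cone_in u) ∘ b
    & fmap Db_shift a ∘ h
      = @fmap _ _ toDb (bcone u) (bshift U) (cone_pr u) ∘ c].

Definition almost_split_triangle (X Y Z : Db)
    (f : mor X Y) (g : mor Y Z) (h : mor Z (Db_shift X)) : Prop :=
  [/\ exact_triangle f g h,
      minimal_left_almost_split f
    & minimal_right_almost_split g].

Definition has_finite_projective_resolution (Z : bcomplex A) : Prop :=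
  exists (P : bcomplex A) (s : chain_map P Z),
    (forall n, @projective A (cx P n)) /\ quasi_iso s.

Definition has_finite_injective_coresolution (X : bcomplex A) : Prop :=
  exists (I : bcomplex A) (s : chain_map X I),
    (forall n, @injective_obj A (cx I n)) /\ quasi_iso s.

End DerivedCategory.

(* Main.v *)
(* Let [P -> Z] be a projective resolution and let [Q] be the part of [P] in
   the degrees [>= m], where [m] is below the degrees in which [Y] and [Z]
   live. If the composite [Q -> P -> Z] factored through [g] in the derived
   category, then the factorization would extend, for degree reasons, to a map
   [P -> Y], and [g] would be a retraction. As [g] is right almost split,
   [Q -> Z] is therefore a retraction, so [P] is homotopy equivalent to a direct
   summand of [Q]; hence the good truncations of [P] in low degrees consist of
   projectives. Morphisms in the localization are handled through the functor
   Hom_K(P, -), where K is the homotopy category: it inverts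
   quasi-isomorphisms, and it is faithful on morphisms out of [Z]. The second part
   is the first one in the opposite category. *)
Require Import Defs.
From mathcomp Require Import all_boot all_order all_algebra.
From mathcomp Require Import boolp zify.
Set Implicit Arguments.
Unset Strict Implicit.
Unset Printing Implicit Defensive.
Import Order.TTheory GRing.Theory Num.Theory.
Local Open Scope ring_scope.
Local Open Scope category_scope.

Local Obligation Tactic := idtac.

(** The resolution [P] is unbounded below, so it is no object of [Db A], and [Hom_K(P, -)] must act
    from outside: on the formal expressions of the localization, as a relation, because lifts along
    quasi-isomorphisms are unique only up to homotopy. An equation in [Db A] is recovered by
    truncating [P] below every complex that occurs in a chosen expression; chain maps and homotopies
    out of [P] then descend to the bounded truncation. Two truncations are involved. The brutal one
    has projective terms but need not resolve [Z]; the good one resolves [Z] but may fail to be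
    projective in its lowest degree, and the retraction is what splits that degree. In the dual
    part, reversing degrees twice turns [n] into [- - n], so a complex agrees with its double
    opposite only up to casts. *)

Lemma dchoice (I : Type) (T : I -> Type) (P : forall i, T i -> Prop) :
  (forall i, exists x, P i x) -> exists f : forall i, T i, forall i, P i (f i).
Proof. by move=> H; exists (fun i => sval (cid (H i))) => i; case: cid. Qed.

(** * Diagram chasing in an abelian category *)

Section Additive.
Variable A : abelian.
Implicit Types X Y Z T U V : pa_obj A.

Lemma pa_cmpBl X Y Z (g h : pa_mor Y Z) (f : pa_mor X Y) :
  (g - h) ∙ f = g ∙ f - h ∙ f.
Proof. by rewrite pa_cmpDl pa_cmpNm. Qed.

Lemma pa_cmpBr X Y Z (g : pa_mor Y Z) (f h : pa_mor X Y) :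
  g ∙ (f - h) = g ∙ f - g ∙ h.
Proof. by rewrite pa_cmpDr pa_cmpmN. Qed.

Lemma epiP X Y (e : pa_mor X Y) :
  @is_epi A X Y e <-> forall T (a : pa_mor Y T), a ∙ e = 0 -> a = 0.
Proof.
split=> [epi T a ae|epi T a b /= ab].
  by apply: epi => /=; rewrite ae pa_cmp0m.
by apply/eqP; rewrite -subr_eq0; apply/eqP/epi; rewrite pa_cmpBl ab subrr.
Qed.

Lemma monoP X Y (f : pa_mor X Y) :
  @is_mono A X Y f <-> forall T (a : pa_mor T X), f ∙ a = 0 -> a = 0.
Proof.
split=> [mono T a ae|mono T a b /= ab].
  by apply: mono => /=; rewrite ae pa_cmpm0.
by apply/eqP; rewrite -subr_eq0; apply/eqP/mono; rewrite pa_cmpBr ab subrr.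
Qed.

Lemma epi_id X : @is_epi A X X (pa_id X).
Proof. by apply/epiP => T a; rewrite pa_cmpm1. Qed.

Lemma epi_cmp X Y Z (f : pa_mor Y Z) (g : pa_mor X Y) :
  @is_epi A _ _ f -> @is_epi A _ _ g -> @is_epi A _ _ (f ∙ g).
Proof.
by move=> /epiP ef /epiP eg; apply/epiP => T a; rewrite pa_cmpmA => /eg /ef.
Qed.

Lemma kernel_mono X Y (f : pa_mor X Y) K (k : pa_mor K X) :
  is_kernel f k -> @is_mono A _ _ k.
Proof.
move=> [fk kU]; apply/monoP => T a ka.
have [|b [_ bU]] := kU T 0; first by rewrite pa_cmpm0.
by rewrite -(bU _ ka) (bU 0) // pa_cmpm0.
Qed.

Lemma cokernel_epi X Y (f : pa_mor X Y) Q (q : pa_mor Y Q) :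
  is_cokernel f q -> @is_epi A _ _ q.
Proof.
move=> [qf qU]; apply/epiP => T a aq.
have [|b [_ bU]] := qU T 0; first by rewrite pa_cmp0m.
by rewrite -(bU _ aq) (bU 0) // pa_cmp0m.
Qed.

Lemma kernel_lift X Y (f : pa_mor X Y) K (k : pa_mor K X) T (a : pa_mor T X) :
  is_kernel f k -> f ∙ a = 0 -> exists b, k ∙ b = a.
Proof. by move=> [_ kU] /kU [b [? _]]; exists b. Qed.

Lemma cokernel_lift X Y (f : pa_mor X Y) Q (q : pa_mor Y Q) T (a : pa_mor Y T) :
  is_cokernel f q -> a ∙ f = 0 -> exists b, b ∙ q = a.
Proof. by move=> [_ qU] /qU [b [? _]]; exists b. Qed.

Lemma zero_objP X : is_zero_obj X <-> pa_id X = 0.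
Proof.
split=> [[X0 _]|X0]; first exact: X0.
split=> T f g.
  by rewrite -(pa_cmpm1 f) -(pa_cmpm1 g) X0 !pa_cmpm0.
by rewrite -(pa_cmp1m f) -(pa_cmp1m g) X0 !pa_cmp0m.
Qed.

Lemma zero_to X Y (f : pa_mor X Y) : is_zero_obj Y -> f = 0.
Proof. by move=> [_]; apply. Qed.

Lemma mono_epi_iso X Y (f : pa_mor X Y) :
  @is_mono A _ _ f -> @is_epi A _ _ f -> @is_iso A _ _ f.
Proof.
move=> mf /epiP ef; have [Z [g gK]] := ab_mono_normal mf.
have g0 := ef _ _ gK.1.
have [|r fr] := kernel_lift (a := pa_id Y) gK; first by rewrite g0 pa_cmp0m.
exists r; split=> //; apply: mf => /=.
by rewrite pa_cmpmA fr pa_cmp1m pa_cmpm1.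
Qed.

(** The map [s] is epi, hence the cokernel of some [g], and [g] factors through the kernel [k]. If
    [a] kills [pr2 B ∙ k], then [a ∙ pr2 B] descends along [s] to a map killing [e], so it vanishes.
    This is what allows chases with elements [T -> V] up to an epimorphic cover of [T]. *)
Lemma epi_pullback V C T (e : pa_mor V C) (t : pa_mor T C) :
  @is_epi A _ _ e -> exists T' (e' : pa_mor T' T) (v : pa_mor T' V),
    @is_epi A _ _ e' /\ e ∙ v = t ∙ e'.
Proof.
move=> ee; pose B := ab_biproduct V T.
pose s := e ∙ pr1 B - t ∙ pr2 B.
have s1 : s ∙ in1 B = e.
  by rewrite pa_cmpBl -!pa_cmpmA pr1_in1 pr2_in1 pa_cmpm1 pa_cmpm0 subr0.
have es : @is_epi A _ _ s.
  move/epiP: ee => ee; apply/epiP => W a as0; apply: ee.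
  by rewrite -s1 pa_cmpmA as0 pa_cmp0m.
have [K [k kK]] := ab_kernel s.
exists K, (pr2 B ∙ k), (pr1 B ∙ k); split; last first.
  by apply/eqP; rewrite -subr_eq0 !pa_cmpmA -pa_cmpBl kK.1.
have [W [g gQ]] := ab_epi_conormal es.
have [g' kg'] := kernel_lift kK gQ.1.
apply/epiP => S a a0.
have [|b bs] := cokernel_lift (a := a ∙ pr2 B) gQ.
  by rewrite -kg' pa_cmpmA -(pa_cmpmA a) a0 pa_cmp0m.
have b0 : b = 0.
  move/epiP: ee; apply; rewrite -s1 pa_cmpmA bs -pa_cmpmA pr2_in1.
  by rewrite pa_cmpm0.
by rewrite -(pa_cmpm1 a) -(pr2_in2 B) pa_cmpmA -bs b0 !pa_cmp0m.
Qed.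

(* The kernel of the cokernel of [a] is the image of [a]. *)
Lemma cokernel_cover U V C (a : pa_mor U V) (q : pa_mor V C) T
    (x : pa_mor T V) :
  is_cokernel a q -> q ∙ x = 0 -> exists T' (e : pa_mor T' T) (u : pa_mor T' U),
    @is_epi A _ _ e /\ a ∙ u = x ∙ e.
Proof.
move=> qC qx; have [K [k kK]] := ab_kernel q.
have [a1 ka1] := kernel_lift kK qC.1; have [x1 kx1] := kernel_lift kK qx.
suff ea1 : @is_epi A _ _ a1.
  have [T' [e [u [ee a1u]]]] := epi_pullback x1 ea1.
  by exists T', e, u; split=> //; rewrite -ka1 -kx1 -!pa_cmpmA a1u.
(* The mono [k ∙ m] is the kernel of some [g]. As [a] factors through [k ∙ m], [g] kills [a]; so [g]
   factors through [q] and kills [k], which makes [m] split epi. *)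
apply/epiP => S s sa1; have [M [m mK]] := ab_kernel s.
have [u mu] := kernel_lift mK sa1.
have mkm : @is_mono A _ _ (k ∙ m).
  move: (kernel_mono kK) (kernel_mono mK) => /monoP mk /monoP mm.
  by apply/monoP => W w; rewrite -pa_cmpmA => /mk /mm.
have [Z [g gK]] := ab_mono_normal mkm.
have [|g' g'q] := cokernel_lift (a := g) qC.
  by rewrite -ka1 -mu !pa_cmpmA -(pa_cmpmA g) gK.1 pa_cmp0m.
have [|r kmr] := kernel_lift (a := k) gK.
  by rewrite -g'q -pa_cmpmA kK.1 pa_cmpm0.
have mr : m ∙ r = pa_id K.
  by apply: (kernel_mono kK) => /=; rewrite pa_cmpmA kmr pa_cmpm1.
by rewrite -(pa_cmpm1 s) -mr pa_cmpmA mK.1 pa_cmp0m.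
Qed.

Lemma projective_section X Y (q : pa_mor X Y) (r : pa_mor Y X) :
  @projective A X -> q ∙ r = pa_id Y -> @projective A Y.
Proof.
move=> pX qr U V e ee f; have [g /= eg] := pX _ _ e ee (f ∙ q).
by exists (g ∙ r) => /=; rewrite pa_cmpmA eg -pa_cmpmA qr pa_cmpm1.
Qed.

Lemma projective_zero X : is_zero_obj X -> @projective A X.
Proof. by move=> X0 U V e ee f; exists 0 => /=; apply: X0.1. Qed.

Lemma biprod_ext X Y (B : biproduct X Y) T (f g : pa_mor T (bip B)) :
  pr1 B ∙ f = pr1 B ∙ g -> pr2 B ∙ f = pr2 B ∙ g -> f = g.
Proof.
move=> f1 f2; rewrite -(pa_cmp1m f) -(pa_cmp1m g) -in_pr !pa_cmpDl.
by rewrite -!pa_cmpmA f1 f2.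
Qed.

Lemma coprod_ext X Y (B : biproduct X Y) T (f g : pa_mor (bip B) T) :
  f ∙ in1 B = g ∙ in1 B -> f ∙ in2 B = g ∙ in2 B -> f = g.
Proof.
move=> f1 f2; rewrite -(pa_cmpm1 f) -(pa_cmpm1 g) -in_pr !pa_cmpDr.
by rewrite !pa_cmpmA f1 f2.
Qed.

Definition pairm X Y (B : biproduct X Y) T (f : pa_mor T X) (g : pa_mor T Y) :
  pa_mor T (bip B) := in1 B ∙ f + in2 B ∙ g.

Lemma pr1_pairm X Y (B : biproduct X Y) T (f : pa_mor T X) (g : pa_mor T Y) :
  pr1 B ∙ pairm B f g = f.
Proof.
by rewrite pa_cmpDr !pa_cmpmA pr1_in1 pr1_in2 pa_cmp1m pa_cmp0m addr0.
Qed.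

Lemma pr2_pairm X Y (B : biproduct X Y) T (f : pa_mor T X) (g : pa_mor T Y) :
  pr2 B ∙ pairm B f g = g.
Proof.
by rewrite pa_cmpDr !pa_cmpmA pr2_in1 pr2_in2 pa_cmp1m pa_cmp0m add0r.
Qed.

Definition copairm X Y (B : biproduct X Y) T (f : pa_mor X T) (g : pa_mor Y T) :
  pa_mor (bip B) T := f ∙ pr1 B + g ∙ pr2 B.

Lemma copairm_in1 X Y (B : biproduct X Y) T (f : pa_mor X T) (g : pa_mor Y T) :
  copairm B f g ∙ in1 B = f.
Proof.
by rewrite pa_cmpDl -!pa_cmpmA pr1_in1 pr2_in1 pa_cmpm1 pa_cmpm0 addr0.
Qed.

Lemma copairm_in2 X Y (B : biproduct X Y) T (f : pa_mor X T) (g : pa_mor Y T) :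
  copairm B f g ∙ in2 B = g.
Proof.
by rewrite pa_cmpDl -!pa_cmpmA pr1_in2 pr2_in2 pa_cmpm1 pa_cmpm0 add0r.
Qed.

End Additive.

(** * Quasi-isomorphisms in terms of generalized elements *)

Section GeneralizedElements.
Variable A : abelian.

(* Injectivity and surjectivity of the map induced by [v : V -> V'] between the
   homologies of [U -a-> V -b-> W] and [U' -a'-> V' -b'-> W']. *)
Definition hom_inj (U V W U' V' : pa_obj A) (a : pa_mor U V) (b : pa_mor V W)
    (a' : pa_mor U' V') (v : pa_mor V V') : Prop :=
  forall T (x : pa_mor T V) (y : pa_mor T U'), b ∙ x = 0 -> v ∙ x = a' ∙ y ->
  exists T' (e : pa_mor T' T) (u : pa_mor T' U),
    @is_epi A _ _ e /\ a ∙ u = x ∙ e.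

Definition hom_surj (V W U' V' W' : pa_obj A) (b : pa_mor V W)
    (a' : pa_mor U' V') (b' : pa_mor V' W') (v : pa_mor V V') : Prop :=
  forall T (y : pa_mor T V'), b' ∙ y = 0 ->
  exists T' (e : pa_mor T' T) (x : pa_mor T' V) (u : pa_mor T' U'),
    [/\ @is_epi A _ _ e, b ∙ x = 0 & v ∙ x + a' ∙ u = y ∙ e].

(** A class in cohomology is a cycle on some [T], up to covers of [T]; the two conditions are then
    mono and epi for the induced map. All later arguments avoid the cohomology objects and use this
    form. *)
Lemma quasi_isoP (X Y : complex A) (f : chain_map X Y) :
  quasi_iso f <-> forall n,
    hom_inj (dif X n) (dif X (n + 1)) (dif Y n) (cm f (n + 1)) /\
    hom_surj (dif X (n + 1)) (dif Y n) (dif Y (n + 1)) (cm f (n + 1)).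
Proof.
split=> [qf n|fP n HX HY h [z [zE hE]]].
  have [HX] := cohomology_exists X n; have [HY] := cohomology_exists Y n.
  have [h [hf _]] := cohomology_map_exists f HX HY.
  have [r /= [rh hr]] := qf _ _ _ _ hf; case: hf => z [zE hE].
  have kY := kernel_mono (cyc_kernel HY).
  split=> [T x y dx fx|T y dy].
    have [x1 x1E] := kernel_lift (cyc_kernel HX) dx.
    have zx1 : z ∙ x1 = bnd HY ∙ y.
      by apply: kY => /=; rewrite !pa_cmpmA zE cyc_in_bnd -fx -pa_cmpmA x1E.
    have px1 : coh_pr HX ∙ x1 = 0.
      rewrite -(pa_cmp1m (coh_pr HX)) -rh -!pa_cmpmA (pa_cmpmA h) hE -pa_cmpmA.
      rewrite zx1 (pa_cmpmA (coh_pr HY)) (coh_cokernel HY).1.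
      by rewrite pa_cmp0m pa_cmpm0.
    have [T' [e [u [ee uE]]]] := cokernel_cover (coh_cokernel HX) px1.
    exists T', e, u; split=> //.
    by rewrite -(cyc_in_bnd HX) -pa_cmpmA uE -x1E pa_cmpmA.
  have [y1 y1E] := kernel_lift (cyc_kernel HY) dy.
  have [T1 [e [k [ee kE]]]] :=
    epi_pullback (r ∙ coh_pr HY ∙ y1) (cokernel_epi (coh_cokernel HX)).
  have [|T2 [e' [w [ee' wE]]]] := @cokernel_cover _ _ _ _ _ _ _
      (y1 ∙ e - z ∙ k) (coh_cokernel HY).
    rewrite pa_cmpBr !pa_cmpmA -hE -(pa_cmpmA h) kE !pa_cmpmA hr pa_cmp1m.
    by rewrite subrr.
  exists T2, (e ∙ e'), (cyc_in HX ∙ k ∙ e'), w; split.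
  - exact: epi_cmp.
  - by rewrite !pa_cmpmA (cyc_kernel HX).1 !pa_cmp0m.
  - rewrite -(cyc_in_bnd HY) -(pa_cmpmA _ (bnd HY)) wE pa_cmpBl.
    by rewrite pa_cmpBr !pa_cmpmA y1E -zE [LHS]addrC subrK.
apply: mono_epi_iso.
  apply/monoP => T t ht.
  have [T1 [e [k [ee kE]]]] :=
    epi_pullback t (cokernel_epi (coh_cokernel HX)).
  have [|T2 [e2 [y [ee2 yE]]]] := @cokernel_cover _ _ _ _ _ _ _
      (z ∙ k) (coh_cokernel HY).
    by rewrite pa_cmpmA -hE -pa_cmpmA kE pa_cmpmA ht pa_cmp0m.
  have [||T3 [e3 [u [ee3 uE]]]] := (fP n).1 _ (cyc_in HX ∙ k ∙ e2) y.
  - by rewrite !pa_cmpmA (cyc_kernel HX).1 !pa_cmp0m.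
  - by rewrite !pa_cmpmA -zE -(cyc_in_bnd HY) -!pa_cmpmA yE -!pa_cmpmA.
  have bu : bnd HX ∙ u = k ∙ e2 ∙ e3.
    apply: (kernel_mono (cyc_kernel HX)) => /=.
    by rewrite !pa_cmpmA cyc_in_bnd.
  move/epiP: (epi_cmp ee (epi_cmp ee2 ee3)); apply.
  rewrite !pa_cmpmA -kE -!pa_cmpmA (pa_cmpmA k) -bu pa_cmpmA.
  by rewrite (coh_cokernel HX).1 pa_cmp0m.
apply/epiP => S s sh; move/epiP: (cokernel_epi (coh_cokernel HY)); apply.
have [|T [e [x [w [ee dx xE]]]]] := (fP n).2 _ (cyc_in HY).
  exact: (cyc_kernel HY).1.
move/epiP: ee; apply.
have [x1 x1E] := kernel_lift (cyc_kernel HX) dx.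
have -> : e = z ∙ x1 + bnd HY ∙ w.
  apply: (kernel_mono (cyc_kernel HY)) => /=.
  by rewrite -xE pa_cmpDr !pa_cmpmA zE cyc_in_bnd -pa_cmpmA x1E.
rewrite pa_cmpDr -!pa_cmpmA (pa_cmpmA (coh_pr HY)) -hE (pa_cmpmA _ (bnd HY)).
by rewrite (coh_cokernel HY).1 pa_cmp0m pa_cmpm0 addr0 !pa_cmpmA sh !pa_cmp0m.
Qed.

End GeneralizedElements.

(** * Choice along the integers, and transport between equal degrees *)

Lemma int_succ_case (P : int -> Prop) : (forall n, P (n + 1)) -> forall n, P n.
Proof. by move=> H n; rewrite -(subrK 1 n). Qed.

(** The value [G n] is specified against every [m] with [m + 1 = n] at once; such an [m] exists and
    is unique, and so is the proof of the equation. *)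
Lemma reindex_family (T : int -> Type) (F : forall n, T (n + 1)) :
  exists G : forall n, T n, forall n, G (n + 1) = F n.
Proof.
have [G GE] : exists G : forall n, T n,
    forall n m (e : m + 1 = n), G n = ecast n (T n) e (F m).
  apply: (@dchoice _ T
    (fun n x => forall m (e : m + 1 = n), x = ecast n _ e _)).
  elim/int_succ_case => n.
  exists (F n) => m e; have emn := addIr 1 e.
  by case: n / emn e => e; rewrite eq_axiomK.
by exists G => n; rewrite (GE _ _ erefl).
Qed.

(* Dependent choice along [..., n + 1, n, n - 1, ...], starting from the
   constant data [s0] in the degrees [n >= N]. *)
Lemma descending_choice (S : int -> Type) (G : forall n, S n -> Prop)
    (R : forall n, S n -> S (n + 1) -> Prop) (N : int) (s0 : forall n, S n) :
  (forall n, N <= n -> G n (s0 n) /\ R n (s0 n) (s0 (n + 1))) ->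
  (forall n s, G (n + 1) s -> exists s', G n s' /\ R n s' s) ->
  exists s : forall n, S n,
    (forall n, N <= n -> s n = s0 n) /\ forall n, R n (s n) (s (n + 1)).
Proof.
move=> base step.
have [nx nxP] : exists nx : forall p : {n : int & S (n + 1)}, S (projT1 p),
    forall p, G _ (projT2 p) -> G _ (nx p) /\ R _ (nx p) (projT2 p).
  apply: (@dchoice _ (fun p => S (projT1 p))
    (fun p x => G _ (projT2 p) -> G _ x /\ R _ x (projT2 p))) => -[n s] /=.
  case: (pselect (G (n + 1) s)) => [/step [s' Hs']|nG]; first by exists s'.
  by exists (s0 n) => /nG.
(* Stage [k] is correct in the degrees [>= N - k]; stage [k + 1] alters only the degree [N - k - 1],
   by one application of [nx]. *)
pose F := nat_rect (fun=> forall n, S n) s0 (fun k f =>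
  dfwith f (nx (existT _ (N - k.+1%:Z) (f (N - k.+1%:Z + 1))))).
have Fout k n : n != N - k.+1%:Z -> F k.+1 n = F k n.
  by move=> ne; rewrite /= dfwith_out // eq_sym.
have Fge k n : N <= n -> F k n = s0 n.
  move=> leNn; elim: k => // k IHk; rewrite Fout ?IHk //.
  by apply/eqP; lia.
have Fst k n j : N - k%:Z <= n -> F (k + j)%N n = F k n.
  move=> le_n; elim: j => [|j IHj]; first by rewrite addn0.
  by rewrite addnS Fout ?IHj //; apply/eqP; lia.
have Finv k n : N - k%:Z <= n -> G n (F k n) /\ R n (F k n) (F k (n + 1)).
  elim: k n => [|k IHk] n le_n; first by apply: base; lia.
  have [->|ne] := eqVneq n (N - k.+1%:Z); last first.
    by rewrite !Fout //; [apply: IHk; lia | apply/eqP; lia].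
  rewrite [F _ (_ + 1)]Fout; last by apply/eqP; lia.
  rewrite [F _ _]/= dfwith_in; apply: (nxP (existT _ _ _)) => /=.
  by apply: (IHk _ _).1; lia.
(* Diagonal choice: stage [|N - n|] is the first in which degree [n < N] is final; for [n >= N] all
   stages agree. *)
exists (fun n => F (absz (N - n)%R) n); split=> [n|n]; first exact: Fge.
have -> : F (absz (N - (n + 1))%R) (n + 1) = F (absz (N - n)%R) (n + 1).
  have [leNn|ltnN] := leP N n; first by rewrite !Fge //; lia.
  have -> : (absz (N - n)%R) = (absz (N - (n + 1))%R + 1)%N by lia.
  by rewrite Fst //; lia.
by apply: (Finv _ _ _).2; lia.
Qed.

Section DegreeCasts.
Variable A : abelian.
Implicit Types X Y : complex A.

(** Serves degrees that are successive only up to a proof, such as [- (n + 1)] and [- n] in an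
    opposite complex. *)
Definition xdif X k n (e : k + 1 = n) : pa_mor (cx X k) (cx X n) :=
  ecast m (pa_mor (cx X k) (cx X m)) e (dif X k).

Definition xcast X m n (e : m = n) : pa_mor (cx X m) (cx X n) :=
  ecast k (pa_mor (cx X m) (cx X k)) e (pa_id (cx X m)).

Lemma xdifE X n (e : n + 1 = n + 1) : xdif X e = dif X n.
Proof. by rewrite /xdif eq_axiomK. Qed.

Lemma xcastE X n (e : n = n) : xcast X e = pa_id (cx X n).
Proof. by rewrite /xcast eq_axiomK. Qed.

Lemma xcast_cmp X k m n (e : k = m) (e' : m = n) (e'' : k = n) :
  xcast X e' ∙ xcast X e = xcast X e''.
Proof. by case: n / e' e''; case: m / e => e; rewrite !xcastE pa_cmp1m. Qed.

Lemma xdif_xcast X j k n (e : j = k) (e' : k + 1 = n) (e'' : j + 1 = n) :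
  xdif X e' ∙ xcast X e = xdif X e''.
Proof. by case: k / e e' => e; rewrite pa_cmpm1 (eq_irrelevance e e''). Qed.

Lemma xcast_xdif X k m n (e : k + 1 = m) (e' : m = n) (e'' : k + 1 = n) :
  xcast X e' ∙ xdif X e = xdif X e''.
Proof. by case: n / e' e'' => e'; rewrite pa_cmp1m (eq_irrelevance e e'). Qed.

Lemma xdif_xdif X k m n (e : k + 1 = m) (e' : m + 1 = n) :
  xdif X e' ∙ xdif X e = 0.
Proof. by case: n / e'; case: m / e; apply: dif_dif. Qed.

Lemma cm_xcast X Y (f : chain_map X Y) m n (e : m = n) :
  cm f n ∙ xcast X e = xcast Y e ∙ cm f m.
Proof. by case: n / e; rewrite pa_cmpm1 pa_cmp1m. Qed.

Lemma cm_xdif X Y (f : chain_map X Y) k n (e : k + 1 = n) :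
  xdif Y e ∙ cm f k = cm f n ∙ xdif X e.
Proof. by case: n / e; apply: cm_dif. Qed.

End DegreeCasts.

(** * Formal inverses in the localization *)

Section Localization.
Variables (C : category) (W : forall X Y : C, mor X Y -> Prop).

Lemma loc_class_cmp (X Y Z : C) (g : loc_expr W Y Z) (f : loc_expr W X Y) :
  loc_class (LCmp g f)
  = @cmp (localization W) X Y Z (loc_class g) (loc_class f).
Proof.
by apply/loc_classP/loc_eq_sym/loc_eq_cmp; apply: loc_repr_class.
Qed.

Lemma loc_invK (X Y : C) (s : mor X Y) (Ws : W s) :
  @cmp (localization W) X Y X (loc_class (LInv Ws)) (fmap (loc_functor W) s)
  = @idm (localization W) X.
Proof.
by apply: etrans (esym (loc_class_cmp _ _)) _; apply/loc_classP/loc_eq_Vm.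
Qed.

Lemma loc_invKV (X Y : C) (s : mor X Y) (Ws : W s) :
  @cmp (localization W) Y X Y (fmap (loc_functor W) s) (loc_class (LInv Ws))
  = @idm (localization W) Y.
Proof.
by apply: etrans (esym (loc_class_cmp _ _)) _; apply/loc_classP/loc_eq_mV.
Qed.

End Localization.

(** * Homotopies *)

Section Homotopy.
Variable A : abelian.
Implicit Types X Y Z T : complex A.

Definition nullhomotopic (X Y : complex A) (f : chain_map X Y) : Prop :=
  exists h : forall n, pa_mor (cx X (n + 1)) (cx Y n),
  forall n, cm f (n + 1) = dif Y n ∙ h n + h (n + 1) ∙ dif X (n + 1).

Definition homotopic (X Y : complex A) (f g : chain_map X Y) : Prop :=
  exists h : forall n, pa_mor (cx X (n + 1)) (cx Y n), forall n,
  cm f (n + 1) - cm g (n + 1) = dif Y n ∙ h n + h (n + 1) ∙ dif X (n + 1).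

Lemma homotopic_refl X Y (f : chain_map X Y) : homotopic f f.
Proof.
by exists (fun=> 0) => n; rewrite subrr pa_cmpm0 pa_cmp0m addr0.
Qed.

Lemma homotopic_sym X Y (f g : chain_map X Y) :
  homotopic f g -> homotopic g f.
Proof.
move=> [h hE]; exists (fun n => - h n) => n.
by rewrite pa_cmpmN pa_cmpNm -opprD -hE opprB.
Qed.

Lemma homotopic_trans X Y (f g k : chain_map X Y) :
  homotopic f g -> homotopic g k -> homotopic f k.
Proof.
move=> [h hE] [h' hE']; exists (fun n => h n + h' n) => n.
rewrite pa_cmpDr pa_cmpDl addrACA -hE -hE' addrA subrK //.
Qed.

Lemma homotopic_cmp X Y Z (f f' : chain_map Y Z) (g g' : chain_map X Y) :
  homotopic f f' -> homotopic g g' ->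
  homotopic (chain_cmp f g) (chain_cmp f' g').
Proof.
move=> [h hE] [k kE]; apply: (@homotopic_trans _ _ _ (chain_cmp f g')).
  exists (fun n => cm f n ∙ k n) => n /=.
  rewrite -pa_cmpBr kE pa_cmpDr !pa_cmpmA cm_dif //.
exists (fun n => h n ∙ cm g' (n + 1)) => n /=.
by rewrite -pa_cmpBl hE pa_cmpDl -!pa_cmpmA cm_dif.
Qed.

Lemma chain_cmpA X Y Z T (h : chain_map Z T) (g : chain_map Y Z)
    (f : chain_map X Y) :
  chain_cmp h (chain_cmp g f) = chain_cmp (chain_cmp h g) f.
Proof. by apply: chain_map_eq => n /=; rewrite pa_cmpmA. Qed.

Lemma chain_cmp1m X Y (f : chain_map X Y) : chain_cmp (chain_id Y) f = f.
Proof. by apply: chain_map_eq => n /=; rewrite pa_cmp1m. Qed.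

Lemma chain_cmpm1 X Y (f : chain_map X Y) : chain_cmp f (chain_id X) = f.
Proof. by apply: chain_map_eq => n /=; rewrite pa_cmpm1. Qed.

Section DirectSum.
Variables X Y : complex A.
Let B n := ab_biproduct (cx X n) (cx Y n).

Program Definition dsum : complex A :=
  @Complex A (fun n => bip (B n))
    (fun n => pairm (B (n + 1)) (dif X n ∙ pr1 (B n)) (dif Y n ∙ pr2 (B n))) _.
Next Obligation.
by move=> n; apply: (@biprod_ext _ _ _ (B (n + 1 + 1)));
  rewrite pa_cmpmA ?pr1_pairm ?pr2_pairm -pa_cmpmA ?pr1_pairm ?pr2_pairm;
  rewrite pa_cmpmA dif_dif pa_cmp0m pa_cmpm0.
Qed.

Program Definition dsum_pr1 : chain_map dsum X :=
  @ChainMap A dsum X (fun n => pr1 (B n)) _.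
Next Obligation. by move=> n /=; rewrite pr1_pairm. Qed.

Program Definition dsum_pair T (f : chain_map T X) (g : chain_map T Y) :
    chain_map T dsum :=
  @ChainMap A T dsum (fun n => pairm (B n) (cm f n) (cm g n)) _.
Next Obligation.
by move=> T f g n /=; apply: (@biprod_ext _ _ _ (B (n + 1)));
  rewrite !pa_cmpmA ?pr1_pairm ?pr2_pairm -pa_cmpmA ?pr1_pairm ?pr2_pairm;
  rewrite cm_dif.
Qed.

Program Definition dsum_copair T (f : chain_map X T) (g : chain_map Y T) :
    chain_map dsum T :=
  @ChainMap A dsum T (fun n => copairm (B n) (cm f n) (cm g n)) _.
Next Obligation.
move=> T f g n /=; rewrite [in RHS]/copairm pa_cmpDl -!pa_cmpmA.
by rewrite pr1_pairm pr2_pairm pa_cmpDr !pa_cmpmA !cm_dif.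
Qed.

Lemma dsum_copair_pair S T (f : chain_map X T) (g : chain_map Y T)
    (u : chain_map S X) (v : chain_map S Y) n :
  cm (chain_cmp (dsum_copair f g) (dsum_pair u v)) n =
  cm f n ∙ cm u n + cm g n ∙ cm v n.
Proof. by rewrite /= /copairm pa_cmpDl -!pa_cmpmA pr1_pairm pr2_pairm. Qed.

Lemma bounded_dsum : bounded X -> bounded Y -> bounded dsum.
Proof.
move=> [N HN] [M HM]; exists (maxn N M) => n.
by rewrite gtn_max => /andP[ltNn ltMn]; apply: is_zero_bip; auto.
Qed.

End DirectSum.

(** The complex [C] is contracted by [k], so the component in [C] of a cycle is the boundary of its
    image under [k]. *)
Lemma quasi_iso_dsum_pr1 (X C : complex A)
    (k : forall n, pa_mor (cx C (n + 1)) (cx C n)) :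
  (forall n, dif C n ∙ k n + k (n + 1) ∙ dif C (n + 1) = pa_id _) ->
  quasi_iso (dsum_pr1 X C).
Proof.
move=> kE; apply/quasi_isoP => n; split=> [T x y dx fx|T y dy].
  exists T, (pa_id T).
  pose B := ab_biproduct (cx X (n + 1)) (cx C (n + 1)).
  exists (pairm _ y (k n ∙ (pr2 B ∙ x))).
  split; first exact: epi_id.
  rewrite pa_cmpm1 /=.
  apply: biprod_ext; rewrite pa_cmpmA ?pr1_pairm ?pr2_pairm.
    by rewrite -pa_cmpmA pr1_pairm -fx.
  rewrite -pa_cmpmA pr2_pairm pa_cmpmA.
  have -> : dif C n ∙ k n = pa_id _ - k (n + 1) ∙ dif C (n + 1).
    by rewrite -(kE n) addrK.
  rewrite pa_cmpBl pa_cmp1m -pa_cmpmA (pa_cmpmA (dif C (n + 1))).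
  have := congr1 (pa_cmp (pr2 _)) dx; rewrite /= pa_cmpmA pr2_pairm => ->.
  by rewrite !pa_cmpm0 subr0.
exists T, (pa_id T), (pairm _ y 0), 0; split; first exact: epi_id.
  rewrite /=; apply: biprod_ext; rewrite pa_cmpmA ?pr1_pairm ?pr2_pairm.
    by rewrite -pa_cmpmA pr1_pairm dy pa_cmpm0.
  by rewrite -pa_cmpmA pr2_pairm !pa_cmpm0.
by rewrite /= pr1_pairm pa_cmpm0 addr0 pa_cmpm1.
Qed.

Section ConeMaps.
Variables (X Y : complex A) (u : chain_map X Y).
Let B n := ab_biproduct (cx X (n + 1)) (cx Y n).

(** The null homotopy is the missing component of [k], on the summand that comes from the shift of
    [X]. *)
Lemma cone_extend T (g : chain_map Y T) :
  nullhomotopic (chain_cmp g u) ->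
  exists k : chain_map (cone u) T, chain_cmp k (cone_in u) = g.
Proof.
move=> [h hE].
have kP n : dif T n ∙ copairm (B n) (h n) (cm g n)
    = copairm (B (n + 1)) (h (n + 1)) (cm g (n + 1)) ∙ cone_dif u n.
  apply: (@coprod_ext _ _ _ (B n)); last first.
    by rewrite -!pa_cmpmA cone_dif_in2 copairm_in2 pa_cmpmA copairm_in2 cm_dif.
  rewrite -!pa_cmpmA copairm_in1 /copairm pa_cmpDl -!pa_cmpmA.
  rewrite !(pa_cmpmA _ (cone_dif u n)) pr1_cone_dif pr2_cone_dif.
  rewrite pa_cmpDl -!pa_cmpmA pr1_in1 pr2_in1 !pa_cmpm0 addr0 !pa_cmpm1.
  by have /= -> := hE n; rewrite pa_cmpmN [RHS]addrC addrK.
exists (@ChainMap A (cone u) T (fun n => copairm (B n) (h n) (cm g n)) kP).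
by apply: chain_map_eq => n /=; rewrite copairm_in2.
Qed.

End ConeMaps.

Definition cone_id_contraction (X : complex A) n :
    pa_mor (cx (cone (chain_id X)) (n + 1)) (cx (cone (chain_id X)) n) :=
  in1 (ab_biproduct (cx X (n + 1)) (cx X n))
  ∙ pr2 (ab_biproduct (cx X (n + 1 + 1)) (cx X (n + 1))).

Lemma cone_id_contractionP (X : complex A) n :
  let C := cone (chain_id X) in
  dif C n ∙ cone_id_contraction X n
  + cone_id_contraction X (n + 1) ∙ dif C (n + 1) = pa_id _.
Proof.
rewrite /= /cone_id_contraction; apply: biprod_ext.
  rewrite pa_cmpDr !pa_cmpmA pr1_cone_dif pr1_in1 pa_cmp1m pr2_cone_dif.
  rewrite -(pa_cmpmA _ (pr1 _)) pr1_in1 !pa_cmpm1 /= pa_cmp1m pa_cmpNm.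
  by rewrite [LHS]addrC addrK.
rewrite pa_cmpDr !pa_cmpmA pr2_in1 !pa_cmp0m addr0 pr2_cone_dif pa_cmpDl.
rewrite -!(pa_cmpmA _ _ (in1 _)) pr1_in1 pr2_in1 pa_cmpm0 addr0 /= !pa_cmpm1.
by rewrite pa_cmp1m.
Qed.

Lemma quasi_iso_Db (X Y : bcomplex A) (s : chain_map X Y) :
  quasi_iso s -> is_iso (@fmap _ _ (toDb A) X Y s).
Proof.
move=> qs; exists (loc_class (@LInv (Cb A) (@Cb_quasi_iso A) X Y s qs)).
split; [exact: loc_invK | exact: loc_invKV].
Qed.

(* Both [f] and [g] factor through the cylinder [X (+) cone (id X)], by maps
   from [X] which are sections of the same quasi-isomorphism. *)
Lemma homotopic_Db (X Y : bcomplex A) (f g : chain_map X Y) :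
  homotopic f g -> @fmap _ _ (toDb A) X Y f = @fmap _ _ (toDb A) X Y g.
Proof.
move=> [h hE]; pose C := cone (chain_id X).
have dP n : dif Y n ∙ (cm f n - cm g n)
    = (cm f (n + 1) - cm g (n + 1)) ∙ dif X n.
  by rewrite pa_cmpBr pa_cmpBl !cm_dif.
(* The null homotopic [f - g] extends to the cone of the identity; combined with [g] on the summand
   [X] it gives a map from the cylinder that restricts to [g] along [i0] and to [f] along [i1]. *)
have [|k kE] := @cone_extend X X (chain_id X) Y (@ChainMap A X Y _ dP).
  by exists h => n; rewrite /= pa_cmpm1 hE.
pose Cyl := BComplex (bounded_dsum (bcx_bounded X)
  (bounded_cone (chain_id X) (bcx_bounded X) (bcx_bounded X))).
have zP n : dif C n ∙ 0 = 0 ∙ dif X n by rewrite pa_cmpm0 pa_cmp0m.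
pose i0 : chain_map X Cyl := dsum_pair (chain_id X) (@ChainMap A X C _ zP).
pose i1 : chain_map X Cyl := dsum_pair (chain_id X) (cone_in (chain_id X)).
pose H : chain_map Cyl Y := dsum_copair g k.
pose s : chain_map Cyl X := dsum_pr1 X C.
have qs : quasi_iso s by apply: quasi_iso_dsum_pr1 (@cone_id_contractionP X).
have fE : f = @cmp (Cb A) X Cyl Y H i1.
  apply: chain_map_eq => n; rewrite [RHS]dsum_copair_pair /= pa_cmpm1.
  by have := congr1 (fun m => cm m n) kE => /= ->; rewrite [RHS]addrC subrK.
have gE : g = @cmp (Cb A) X Cyl Y H i0.
  apply: chain_map_eq => n; rewrite [RHS]dsum_copair_pair /= pa_cmpm1.
  by rewrite pa_cmpm0 addr0.
have si0 : @cmp (Cb A) X Cyl X s i0 = @idm (Cb A) X.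
  by apply: chain_map_eq => n /=; rewrite pr1_pairm.
have si1 : @cmp (Cb A) X Cyl X s i1 = @idm (Cb A) X.
  by apply: chain_map_eq => n /=; rewrite pr1_pairm.
have [r [rs _]] := quasi_iso_Db qs.
rewrite fE gE !fmapM; congr (_ ∘ _).
rewrite -[LHS]cmp1m -[RHS]cmp1m -rs -!cmpmA.
by rewrite -!fmapM si0 si1.
Qed.

End Homotopy.

(** * Maps from complexes of projectives up to homotopy *)

Section FromProjectives.
Variables (A : abelian).

(** Exactness tested on projective [T], where covers split and a preimage exists on [T] itself. *)
Definition projective_acyclic (C : complex A) : Prop :=
  forall n T (x : pa_mor T (cx C (n + 1))), @projective A T ->
  dif C (n + 1) ∙ x = 0 -> exists y, dif C n ∙ y = x.

(** A cycle of the cone is a pair [(x1, x2)]. Injectivity on cohomology gives [x0] with boundary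
    [x1], and [x2 + s x0] is then a cycle; surjectivity makes it the image of a cycle plus a
    boundary. *)
Lemma projective_acyclic_cone (V W : complex A) (s : chain_map V W) :
  quasi_iso s -> projective_acyclic (cone s).
Proof.
move=> /quasi_isoP qs n T x pT dx.
set x1 := pr1 (ab_biproduct (cx V (n + 1 + 1)) (cx W (n + 1))) ∙ x.
set x2 := pr2 (ab_biproduct (cx V (n + 1 + 1)) (cx W (n + 1))) ∙ x.
have dx1 : dif V (n + 1 + 1) ∙ x1 = 0.
  apply: oppr_inj; rewrite oppr0 -pa_cmpNm pa_cmpmA -(pr1_cone_dif s) -pa_cmpmA.
  by rewrite dx pa_cmpm0.
have sx12 : cm s (n + 1 + 1) ∙ x1 + dif W (n + 1) ∙ x2 = 0.
  by rewrite !pa_cmpmA -pa_cmpDl -(pr2_cone_dif s) -pa_cmpmA dx pa_cmpm0.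
have [|T1 [e [u [ee uE]]]] := (qs (n + 1)).1 _ x1 (- x2) dx1.
  by apply/eqP; rewrite pa_cmpmN -subr_eq0 opprK sx12.
have [r /= er] := pT _ _ _ ee (pa_id T).
have [x0 x0E] : exists x0, dif V (n + 1) ∙ x0 = x1.
  by exists (u ∙ r); rewrite pa_cmpmA uE -pa_cmpmA er pa_cmpm1.
have [|T2 [e2 [p [q [ee2 dp pqE]]]]] := (qs n).2 _ (x2 + cm s (n + 1) ∙ x0).
  rewrite pa_cmpDr (pa_cmpmA _ (cm s _)) cm_dif -(pa_cmpmA _ _ x0) x0E.
  by rewrite [LHS]addrC.
have [r2 /= er2] := pT _ _ _ ee2 (pa_id T).
exists (pairm _ (p ∙ r2 - x0) (q ∙ r2)); apply: biprod_ext.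
  rewrite pa_cmpmA pr1_cone_dif -pa_cmpmA pr1_pairm pa_cmpBr !pa_cmpNm.
  by rewrite pa_cmpmA dp pa_cmp0m oppr0 sub0r opprK.
rewrite pa_cmpmA pr2_cone_dif pa_cmpDl -!pa_cmpmA pr1_pairm pr2_pairm.
rewrite pa_cmpBr [LHS]addrAC !pa_cmpmA -pa_cmpDl pqE -pa_cmpmA er2 pa_cmpm1.
by rewrite addrK.
Qed.

Section FixedSource.
Variables (P : complex A) (N : int).
Hypothesis P_proj : forall n, @projective A (cx P n).
Hypothesis P_bounded : forall n, N < n -> is_zero_obj (cx P n).

Lemma nullhomotopic_acyclic (C : complex A) (c : chain_map P C) :
  projective_acyclic C -> nullhomotopic c.
Proof.
move=> acC.
(* The induction descends from [N], above which [P] vanishes. The invariant says that what the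
   homotopy still has to account for one degree lower is a cycle, hence a boundary. *)
have [||h [_ hE]] := @descending_choice
  (fun n => pa_mor (cx P (n + 1)) (cx C n))
  (fun n h => (cm c (n + 1) - dif C n ∙ h) ∙ dif P n = 0)
  (fun n h h' => cm c (n + 1) = dif C n ∙ h + h' ∙ dif P (n + 1))
  N (fun=> 0).
- move=> n leNn; have P0 : is_zero_obj (cx P (n + 1)) by apply: P_bounded; lia.
  split; last exact: P0.1.
  by rewrite [X in _ ∙ X](zero_to _ P0) pa_cmpm0.
- move=> n h h0.
  have [|h' h'E] := acC n _ (cm c (n + 1) - h ∙ dif P (n + 1)) (@P_proj _).
    by rewrite pa_cmpBr cm_dif pa_cmpmA -pa_cmpBl.
  exists h'; rewrite h'E subrK opprB [_ + (_ - _)]addrC subrK -pa_cmpmA.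
  by rewrite dif_dif pa_cmpm0.
by exists h.
Qed.

End FixedSource.

Section Lifting.
Variables (P : complex A) (N : int).
Hypothesis P_proj : forall n, @projective A (cx P n).
Hypothesis P_bounded : forall n, N < n -> is_zero_obj (cx P n).
Variables (V W : complex A) (s : chain_map V W).
Hypothesis qs : quasi_iso s.

(** Composed with the inclusion into the cone of [s], [a] becomes null homotopic. The two components
    of the null homotopy are the lift and a homotopy between [a] and the image of the lift. *)
Lemma lift_exists (a : chain_map P W) :
  exists b : chain_map P V, homotopic (chain_cmp s b) a.
Proof.
have [h hE] := nullhomotopic_acyclic P_proj P_bounded
  (chain_cmp (cone_in s) a) (projective_acyclic_cone qs).
have [b bE] := @reindex_family (fun n => pa_mor (cx P n) (cx V n))
  (fun n => pr1 _ ∙ h n).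
have bP n : dif V n ∙ b n = b (n + 1) ∙ dif P n.
  elim/int_succ_case: n => n; rewrite !bE.
  have := congr1 (pa_cmp (pr1 _)) (hE n) => /=.
  rewrite pa_cmpmA pr1_in2 pa_cmp0m pa_cmpDr !pa_cmpmA pr1_cone_dif.
  by rewrite !pa_cmpNm => /esym/eqP; rewrite addr_eq0 eqr_opp => /eqP <-.
exists (ChainMap bP); apply: homotopic_sym; exists (fun n => pr2 _ ∙ h n) => n.
have := congr1 (pa_cmp (pr2 _)) (hE n); rewrite /= bE.
rewrite pa_cmpmA pr2_in2 pa_cmp1m pa_cmpDr !pa_cmpmA pr2_cone_dif => ->.
by rewrite pa_cmpDl -[X in X - _ = _]addrA [X in X - _ = _]addrC addrK.
Qed.

(** The difference [b - b'] and [- h] form a chain map from the shift of [P] to the cone of [s]; the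
    first component of its null homotopy is, up to sign, the homotopy sought. *)
Lemma lift_unique (b b' : chain_map P V) :
  homotopic (chain_cmp s b) (chain_cmp s b') -> homotopic b b'.
Proof.
move=> [h /= hE].
have cP n : dif (cone s) n
      ∙ pairm (ab_biproduct _ _) (cm b (n + 1) - cm b' (n + 1)) (- h n)
    = pairm (ab_biproduct _ _) (cm b (n + 1 + 1) - cm b' (n + 1 + 1))
        (- h (n + 1)) ∙ dif (cx_shift P) n.
  apply: biprod_ext; rewrite !pa_cmpmA ?pr1_cone_dif ?pr2_cone_dif /=.
    rewrite -[LHS]pa_cmpmA !pr1_pairm !pa_cmpNm pa_cmpmN.
    by rewrite pa_cmpBl pa_cmpBr !cm_dif.
  rewrite pa_cmpDl -(pa_cmpmA (cm s _)) -(pa_cmpmA (dif W _)).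
  rewrite pr1_pairm !pr2_pairm pa_cmpBr hE pa_cmpNm.
  by rewrite !pa_cmpmN opprK addrAC subrr add0r.
have [k kE] := @nullhomotopic_acyclic (cx_shift P) N
  (fun n => @P_proj (n + 1)) (fun n ltNn => P_bounded (ltr_wpDr ler01 ltNn))
  _ (@ChainMap A (cx_shift P) (cone s) _ cP) (projective_acyclic_cone qs).
have [h' h'E] := @reindex_family (fun n => pa_mor (cx P (n + 1)) (cx V n))
  (fun n => - (pr1 _ ∙ k n)).
exists h'; elim/int_succ_case => n; rewrite !h'E.
have := congr1 (pa_cmp (pr1 _)) (kE n) => /=.
rewrite pr1_pairm => ->; rewrite pa_cmpDr !pa_cmpmA pr1_cone_dif.
by rewrite pa_cmpNm pa_cmpmN !pa_cmpNm !pa_cmpmN !pa_cmpmA.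
Qed.

End Lifting.

(* [loc_act e a b] expresses that the functor [Hom_K(P, -)], where [K] is the
   homotopy category, which inverts quasi-isomorphisms, maps the class of [a]
   along [e] to the class of [b]. *)
Section Action.
Variables (P : complex A) (N : int).
Hypothesis P_proj : forall n, @projective A (cx P n).
Hypothesis P_bounded : forall n, N < n -> is_zero_obj (cx P n).

Local Notation expr := (@loc_expr (Cb A) (@Cb_quasi_iso A)).
Implicit Types X Y Z : bcomplex A.

Fixpoint loc_act (X Y : Cb A) (e : expr X Y) :
    chain_map P (X : bcomplex A) -> chain_map P (Y : bcomplex A) -> Prop :=
  match e with
  | LMor _ _ f => fun a b => homotopic (chain_cmp f a) b
  | LInv _ _ s _ => fun a b => homotopic a (chain_cmp s b)
  | LCmp _ _ _ g f => fun a b => exists c, loc_act f a c /\ loc_act g c b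
  end.

Lemma loc_act_total X Y (e : expr X Y) a : exists b, loc_act e a b.
Proof.
elim: e a => {X Y} [X Y f|X Y s qs|X Y Z g IHg f IHf] /= a.
- by exists (chain_cmp f a); apply: homotopic_refl.
- have [b bE] := lift_exists P_proj P_bounded qs a.
  by exists b; apply: homotopic_sym.
- by have [c fac] := IHf a; have [b gcb] := IHg c; exists b, c.
Qed.

Lemma loc_act_homotopic X Y (e : expr X Y) a a' b b' :
  homotopic a a' -> homotopic b b' -> loc_act e a b -> loc_act e a' b'.
Proof.
elim: e a a' b b' => {X Y} [X Y f|X Y s qs|X Y Z g IHg f IHf] /= a a' b b'.
- move=> aa bb ab; apply: homotopic_trans bb; apply: homotopic_trans ab.
  by apply: homotopic_cmp (homotopic_refl _) _; apply: homotopic_sym.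
- move=> aa bb ab; apply: homotopic_trans (homotopic_sym aa) _.
  by apply: homotopic_trans ab _; apply: homotopic_cmp (homotopic_refl _) bb.
- move=> aa bb [c [fac gcb]]; exists c; split.
    exact: IHf aa (homotopic_refl _) fac.
  exact: IHg (homotopic_refl _) bb gcb.
Qed.

(** Makes the action well defined on morphisms of [Db A]. Lifting enters in the relations for formal
    inverses: its uniqueness for [loc_eq_Vm], its existence for [loc_eq_mV]. *)
Lemma loc_act_eq X Y (e e' : expr X Y) a b :
  loc_eq e e' -> loc_act e a b <-> loc_act e' a b.
Proof.
move=> ee; elim: ee a b => {X Y e e'} //=.
- by move=> X Y e e' _ IH a b; rewrite IH.
- by move=> X Y e1 e2 e3 _ IH1 _ IH2 a b; rewrite IH1.
- move=> X Y Z g g' f f' _ IHg _ IHf a b.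
  by split=> -[c [/IHf ? /IHg ?]]; exists c.
- move=> X Y e a b; split=> [[c [ac]]|ab].
    by rewrite chain_cmp1m => cb; apply: loc_act_homotopic cb ac;
      apply: homotopic_refl.
  by exists b; split=> //; rewrite chain_cmp1m; apply: homotopic_refl.
- move=> X Y e a b; split=> [[c []]|ab].
    rewrite chain_cmp1m => /homotopic_sym ca; apply: loc_act_homotopic => //.
    exact: homotopic_refl.
  by exists a; split=> //; rewrite chain_cmp1m; apply: homotopic_refl.
- move=> X Y Z T h g f a b; split.
    by move=> [c [[d [ad dc]] cb]]; exists d; split=> //; exists c.
  by move=> [c [ac [d [cd db]]]]; exists d; split=> //; exists c.
- move=> X Y Z g f a b; rewrite -chain_cmpA; split=> [ab|[c [ac cb]]].
    by exists (chain_cmp f a); split=> //; apply: homotopic_refl.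
  by apply: homotopic_trans cb; apply: homotopic_cmp (homotopic_refl _) ac.
- move=> X Y s qs a b; rewrite chain_cmp1m; split=> [[c [ac cb]]|ab].
    apply: (lift_unique P_proj P_bounded qs).
    exact: homotopic_trans ac cb.
  exists (chain_cmp s a); split; first exact: homotopic_refl.
  exact: homotopic_cmp (homotopic_refl _) ab.
- move=> X Y s qs a b; rewrite chain_cmp1m; split=> [[c [ac cb]]|ab].
    exact: homotopic_trans ac cb.
  have [c cE] := lift_exists P_proj P_bounded qs a.
  exists c; split; first exact: homotopic_sym.
  exact: homotopic_trans cE ab.
Qed.

Definition act (X Y : Db A) (f : mor X Y) := loc_act (loc_repr f).

Lemma act_class X Y (e : expr X Y) a b :
  @act X Y (loc_class e) a b <-> loc_act e a b.
Proof. exact/loc_act_eq/loc_repr_class. Qed.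

Lemma act_toDb X Y (f : chain_map X Y) a b :
  act (@fmap _ _ (toDb A) X Y f) a b <-> homotopic (chain_cmp f a) b.
Proof. exact: act_class. Qed.

Lemma act_id X a b : act (@idm (Db A) X) a b <-> homotopic a b.
Proof. by rewrite act_class /= chain_cmp1m. Qed.

Lemma act_cmp X Y Z (g : @mor (Db A) Y Z) (f : @mor (Db A) X Y) a b :
  act (g ∘ f) a b <-> exists c, act f a c /\ act g c b.
Proof. exact: act_class. Qed.

End Action.

End FromProjectives.

(** * Projective resolutions and their truncations *)

Section Resolution.
Variable A : abelian.

Lemma bounded_above (X : bcomplex A) :
  exists N : nat, forall n : int,
    n < - N%:Z \/ N%:Z < n -> is_zero_obj (cx X n).
Proof. by have [N HN] := bcx_bounded X; exists N => n Hn; apply: HN; lia. Qed.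

(* Exactness of [P -> Z] in a form which is convenient for constructing [P]
   degree by degree: it says that [P n] covers the pairs of a cycle of
   [P (n + 1)] and of an element of [Z n] with the same image in [Z (n + 1)]. *)
Definition resolves (P Z : complex A) (p : chain_map P Z) : Prop :=
  forall n T (x : pa_mor T (cx P (n + 1))) (z : pa_mor T (cx Z n)),
  dif P (n + 1) ∙ x = 0 -> cm p (n + 1) ∙ x = dif Z n ∙ z ->
  exists T' (e : pa_mor T' T) (y : pa_mor T' (cx P n)),
    [/\ @is_epi A _ _ e, dif P n ∙ y = x ∙ e & cm p n ∙ y = z ∙ e].

Lemma resolves_surj (P Z : complex A) (p : chain_map P Z) :
  resolves p ->
  forall n, hom_surj (dif P (n + 1)) (dif Z n) (dif Z (n + 1)) (cm p (n + 1)).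
Proof.
move=> rp n T y dy; have [||T' [e [x [ee dx px]]]] := rp (n + 1) T 0 y.
- exact: pa_cmpm0.
- by rewrite pa_cmpm0 dy.
by exists T', e, x, 0; split; rewrite ?dx ?px ?pa_cmp0m // pa_cmpm0 addr0.
Qed.

Lemma resolves_quasi_iso (P Z : complex A) (p : chain_map P Z) :
  resolves p -> quasi_iso p.
Proof.
move=> rp; apply/quasi_isoP => n; split; last exact: resolves_surj.
move=> T x y dx px; have [T' [e [u [ee uE _]]]] := rp n T x y dx px.
by exists T', e, u.
Qed.

(** One degree of the resolution: its term, the cycles in it and the map to [Z]. The differential
    joins two degrees and is therefore left to the relation between successive stages. *)
Record partial_resolution (Z : complex A) (n : int) := PartialResolution {
  pr_obj : A;
  pr_cyc : A;
  pr_in : pa_mor pr_cyc pr_obj;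
  pr_map : pa_mor pr_obj (cx Z n) }.

Lemma projective_resolution (Z : complex A) (N : int) :
  enough_projectives A -> (forall n, N < n -> is_zero_obj (cx Z n)) ->
  exists (P : complex A) (p : chain_map P Z),
    [/\ forall n, @projective A (cx P n),
        forall n, N < n -> is_zero_obj (cx P n) & resolves p].
Proof.
move=> enough Z0; have [O O0] := ab_zero A.
pose R n (s : partial_resolution Z n) (s' : partial_resolution Z (n + 1)) :=
  exists d : pa_mor (pr_obj s) (pr_obj s'),
  [/\ @projective A (pr_obj s), pr_map s' ∙ d = dif Z n ∙ pr_map s,
      is_kernel d (pr_in s), exists r, d = pr_in s' ∙ r &
      forall T (x : pa_mor T (pr_cyc s')) (z : pa_mor T (cx Z n)),
        pr_map s' ∙ pr_in s' ∙ x = dif Z n ∙ z ->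
        exists T' (e : pa_mor T' T) (y : pa_mor T' (pr_obj s)),
        [/\ @is_epi A _ _ e, d ∙ y = pr_in s' ∙ x ∙ e & pr_map s ∙ y = z ∙ e]].
have [||S [S0 SR]] := @descending_choice (partial_resolution Z)
  (fun _ _ => True) R (N + 1)
  (fun n => PartialResolution (pa_id O) (0 : pa_mor O (cx Z n))).
- move=> n leNn; split=> //; exists 0; split=> /=.
  + exact: projective_zero.
  + exact: O0.1.
  + split; first exact: O0.1.
    by move=> T a _; exists a; split=> [|b _]; apply: O0.2.
  + by exists 0; apply: O0.1.
  + move=> T x z _; exists T, (pa_id T), 0; split; first exact: epi_id.
      exact: O0.2.
    by apply: (Z0 n _).2; lia.
- move=> n s _; pose B := ab_biproduct (pr_cyc s) (cx Z n).
  (* The object [M] is the fibre product over [Z (n + 1)] of the cycles in degree [n + 1] and [Z n];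
     the new term is a projective mapping onto it. *)
  have [M [k kK]] :=
    ab_kernel (pr_map s ∙ pr_in s ∙ pr1 B - dif Z n ∙ pr2 B).
  have [Q [c [Qproj ce]]] := enough M.
  pose d := pr_in s ∙ (pr1 B ∙ k ∙ c).
  have [K [i iK]] := ab_kernel d.
  exists (PartialResolution i (pr2 B ∙ k ∙ c)); split=> //.
  exists d; split=> //=.
  + rewrite !pa_cmpmA; congr (_ ∙ c); apply/eqP.
    by rewrite -subr_eq0 -pa_cmpBl kK.1.
  + by exists (pr1 B ∙ k ∙ c).
  + move=> T x z xz; have [|t tE] := kernel_lift (a := pairm B x z) kK.
      by rewrite pa_cmpBl -!pa_cmpmA pr1_pairm pr2_pairm pa_cmpmA xz subrr.
    have [T' [e [y [ee yE]]]] := epi_pullback t ce.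
    exists T', e, y; split=> //.
      rewrite /d -!pa_cmpmA yE (pa_cmpmA k) tE !pa_cmpmA -(pa_cmpmA (pr_in s)).
      by rewrite pr1_pairm.
    by rewrite -!pa_cmpmA yE (pa_cmpmA k) tE pa_cmpmA pr2_pairm.
have [d dP] :=
  @dchoice _ (fun n => pa_mor (pr_obj (S n)) (pr_obj (S (n + 1)))) _ SR.
have dd n : d (n + 1) ∙ d n = 0.
  have [_ _ _ [r ->] _] := dP n; have [_ _ [dk _] _ _] := dP (n + 1).
  by rewrite pa_cmpmA dk pa_cmp0m.
pose P := Complex dd.
have pP n : dif Z n ∙ pr_map (S n) = pr_map (S (n + 1)) ∙ dif P n.
  by have [_ -> _ _ _] := dP n.
exists P, (@ChainMap _ P Z (fun n => pr_map (S n)) pP).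
split=> [n|n ltNn|n T x z dx px].
- by have [] := dP n.
- by rewrite /= S0 //; lia.
have [_ _ _ _ cov] := dP n; have [_ _ kK _ _] := dP (n + 1).
have [x1 x1E] := kernel_lift kK dx.
by rewrite -x1E; apply: cov; rewrite -pa_cmpmA x1E.
Qed.

(** * The good truncation of a complex *)

Section Truncation.
Variables (P : complex A) (l : int).

(* The maps from [P n] which factor through the truncation [P n -> T n] of [P]
   to the degrees [>= l] (by the cokernel of the differential in degree [l]). *)
Definition truncatable n V (a : pa_mor (cx P n) V) : Prop :=
  (n < l -> a = 0) /\
  forall k (e : k + 1 = n), n = l -> a ∙ xdif P e = 0.

Lemma truncatableS n V (a : pa_mor (cx P (n + 1)) V) :
  (n + 1 < l -> a = 0) -> (n + 1 = l -> a ∙ dif P n = 0) -> truncatable a.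
Proof.
move=> a0 ad; split=> // k e; have kn := addIr 1 e.
by case: n / kn e a a0 ad => e a a0 ad; rewrite xdifE.
Qed.

Definition is_truncation (T : complex A) (q : chain_map P T) : Prop :=
  forall n, [/\ @is_epi A _ _ (cm q n), truncatable (cm q n)
    & forall V (a : pa_mor (cx P n) V), truncatable a ->
        exists b, b ∙ cm q n = a].

Lemma truncation_exists :
  exists (T : complex A) (q : chain_map P T), is_truncation q.
Proof.
pose D n T : Type := pa_mor (cx P n) T.
have /(@dchoice int (fun n => {T & D n T})) [Tq TqP] :
    forall n, exists Tq : {T & D n T},
    [/\ @is_epi A _ _ (projT2 Tq), truncatable (projT2 Tq)
    & forall V (a : pa_mor (cx P n) V), truncatable a ->
        exists b, b ∙ projT2 Tq = a].
  elim/int_succ_case => n; have [lt_nl|lt_ln|nl] := ltgtP (n + 1) l.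
  - have [O O0] := ab_zero A; exists (existT (D (n + 1)) O 0); split=> /=.
    + by apply/epiP => V a _; apply: O0.1.
    + by split=> *; rewrite ?pa_cmp0m.
    + by move=> V a [/(_ lt_nl) -> _]; exists 0; rewrite pa_cmpm0.
  - exists (existT (D (n + 1)) _ (pa_id _)); split=> /=.
    + exact: epi_id.
    + by apply: truncatableS => H; exfalso; lia.
    + by move=> V a _; exists a; rewrite pa_cmpm1.
  - have [Q [q qQ]] := ab_cokernel (dif P n).
    exists (existT (D (n + 1)) Q q); split=> /=.
    + exact: cokernel_epi qQ.
    + by apply: truncatableS => [lt_nl|_]; [exfalso; lia | exact: qQ.1].
    + move=> V a [_ /(_ n erefl nl) ad]; exact: cokernel_lift qQ ad.
pose T n := projT1 (Tq n); pose q n : pa_mor (cx P n) (T n) := projT2 (Tq n).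
have qd n : truncatable (q (n + 1) ∙ dif P n).
  split=> [lt_nl|].
    have [_ [q0 qd] _] := TqP (n + 1).
    have [lt_nl1|/eqP nl] : n + 1 < l \/ n + 1 == l by lia.
      by rewrite /q q0 // pa_cmp0m.
    exact: (qd n erefl nl).
  by move=> k; case: n / => _ /=; rewrite -pa_cmpmA dif_dif pa_cmpm0.
have /(@dchoice int (fun n => pa_mor (T n) (T (n + 1)))) [d dP] n :
    exists d, d ∙ q n = q (n + 1) ∙ dif P n.
  by have [_ _ qU] := TqP n; apply: qU (qd n).
have dd n : d (n + 1) ∙ d n = 0.
  have [/epiP qe _ _] := TqP n; apply: qe.
  by rewrite -pa_cmpmA dP pa_cmpmA dP -pa_cmpmA dif_dif pa_cmpm0.
by exists (Complex dd), (@ChainMap _ P (Complex dd) q dP).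
Qed.

Variables (T : complex A) (q : chain_map P T).
Hypothesis qT : is_truncation q.

Lemma truncation_zero n : n < l -> is_zero_obj (cx T n).
Proof.
move=> lt_nl; have [/epiP qe [q0 _] _] := qT n; apply/zero_objP/qe.
by rewrite q0 // pa_cmpm0.
Qed.

Lemma truncation_retract n : l < n -> exists r, r ∙ cm q n = pa_id (cx P n).
Proof.
move=> lt_ln; have [_ _ qU] := qT n; apply: qU.
by split=> [lt_nl|k e nl]; exfalso; lia.
Qed.

Lemma truncation_bounded N :
  (forall n, N < n -> is_zero_obj (cx P n)) -> bounded T.
Proof.
move=> P0; exists (maxn `|l| `|N|) => n lt_n.
have [/truncation_zero //|lt_Nn] : n < l \/ N < n by lia.
have [/epiP qe _ _] := qT n; apply/zero_objP/qe; exact: (P0 n lt_Nn).1.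
Qed.

Variable V : complex A.
Hypothesis V0 : forall n, n < l -> is_zero_obj (cx V n).

(** A chain map to [V] kills the image of the differential into degree [l], since on that image it
    passes through [V] in degree [l - 1], which is zero. *)
Lemma truncation_factor (a : chain_map P V) :
  exists b : chain_map T V, chain_cmp b q = a.
Proof.
have /(@dchoice int (fun n => pa_mor (cx T n) (cx V n))) [b bE] n :
    exists b, b ∙ cm q n = cm a n.
  have [_ _] := qT n; apply; split=> [/V0 Vn0|k e nl]; first exact: Vn0.2.
  case: n / e nl => nl; rewrite -cm_dif (zero_to (cm a k)) ?pa_cmpm0 //.
  by apply: V0; rewrite -nl; lia.
have bP n : dif V n ∙ b n = b (n + 1) ∙ dif T n.
  have [qe _ _] := qT n; apply: qe => /=.
  by rewrite -!pa_cmpmA bE cm_dif cm_dif pa_cmpmA bE.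
by exists (@ChainMap _ T V b bP); apply: chain_map_eq.
Qed.

(** A component [h n] can be nonzero only for [n >= l]; its source [P (n + 1)] is then strictly
    above [l], where the truncation changes nothing. *)
Lemma truncation_homotopic (a b : chain_map T V) :
  homotopic (chain_cmp a q) (chain_cmp b q) -> homotopic a b.
Proof.
move=> [h hE].
have /(@dchoice int (fun n => pa_mor (cx T (n + 1)) (cx V n))) [k kE] n :
    exists k, k ∙ cm q (n + 1) = h n.
  have [_ _] := qT (n + 1); apply; apply: truncatableS => nl.
    by apply: zero_to; apply: V0; lia.
  by rewrite (zero_to (h n)) ?pa_cmp0m //; apply: V0; lia.
exists k => n; have [qe _ _] := qT (n + 1); apply: qe => /=.
rewrite pa_cmpBl pa_cmpDl -!pa_cmpmA kE cm_dif pa_cmpmA kE.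
exact: hE.
Qed.

End Truncation.

Lemma truncation_quasi_iso (P Z T : complex A) (p : chain_map P Z) l
    (q : chain_map P T) (s : chain_map T Z) :
  is_truncation l q -> resolves p -> chain_cmp s q = p -> quasi_iso s.
Proof.
move=> qT rp sq; have sqn n : cm s n ∙ cm q n = cm p n by rewrite -sq.
apply/quasi_isoP => n; split=> [S x y dx sx|S y dy]; last first.
  have [S' [e [x [u [ee dpx xE]]]]] := resolves_surj rp dy.
  exists S', e, (cm q (n + 1) ∙ x), u; split=> //.
    by rewrite pa_cmpmA cm_dif -pa_cmpmA dpx pa_cmpm0.
  by rewrite pa_cmpmA sqn.
have [lt_nl|le_ln] := ltP (n + 1) l.
  exists S, (pa_id S), 0; split; first exact: epi_id.
  exact: (truncation_zero qT lt_nl).2.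
have [qe _ _] := qT (n + 1); have [S1 [e1 [x1 [ee1 x1E]]]] := epi_pullback x qe.
(* The degree [n + 1 + 1] is strictly above [l], so [q] is split mono there and any lift of the
   cycle [x] to [P] is again a cycle. *)
have [|r rq] := @truncation_retract _ _ _ _ qT (n + 1 + 1); first by lia.
have [||S2 [e2 [u [ee2 uE _]]]] := rp n S1 x1 (y ∙ e1).
- rewrite -(pa_cmp1m (_ ∙ x1)) -rq -pa_cmpmA (pa_cmpmA (cm q _)) -cm_dif.
  by rewrite -pa_cmpmA x1E (pa_cmpmA (dif T _)) dx pa_cmp0m pa_cmpm0.
- by rewrite -sqn -pa_cmpmA x1E !pa_cmpmA sx.
exists S2, (e1 ∙ e2), (cm q n ∙ u); split; first exact: epi_cmp.
by rewrite pa_cmpmA cm_dif -pa_cmpmA uE !pa_cmpmA x1E.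
Qed.

Section BrutalTruncation.
Variables (P : complex A) (m : int).

Lemma brutal_truncation : exists (Q : complex A) (j : chain_map Q P)
    (r : forall n, pa_mor (cx P n) (cx Q n)),
  [/\ forall n, r n ∙ cm j n = pa_id _,
      forall n, m <= n -> cm j n ∙ r n = pa_id _
    & forall n, n < m -> is_zero_obj (cx Q n)].
Proof.
pose D n Q := (pa_mor Q (cx P n) * pa_mor (cx P n) Q)%type.
have /(@dchoice int (fun n => {Q & D n Q})) [Qj QjP] n :
    exists Qj : {Q & D n Q},
    [/\ (projT2 Qj).2 ∙ (projT2 Qj).1 = pa_id _,
        m <= n -> (projT2 Qj).1 ∙ (projT2 Qj).2 = pa_id _
      & n < m -> is_zero_obj (projT1 Qj)].
  have [le_mn|lt_nm] := leP m n.
    exists (existT (D n) _ (pa_id _, pa_id _)).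
    by split=> //=; rewrite pa_cmp1m.
  have [O O0] := ab_zero A.
  by exists (existT (D n) O (0, 0)); split=> //=; apply: O0.1.
pose Q n := projT1 (Qj n).
pose j n : pa_mor (Q n) (cx P n) := (projT2 (Qj n)).1.
pose r n : pa_mor (cx P n) (Q n) := (projT2 (Qj n)).2.
pose d n := r (n + 1) ∙ dif P n ∙ j n.
have jd n : dif P n ∙ j n = j (n + 1) ∙ d n.
  have [_ jr Q0] := QjP (n + 1); rewrite /d !pa_cmpmA.
  have [le_mn|lt_nm] := leP m (n + 1); first by rewrite jr // pa_cmp1m.
  by have [_ _ Qn0] := QjP n; apply: (Qn0 _).1; lia.
have dd n : d (n + 1) ∙ d n = 0.
  by rewrite {1}/d -pa_cmpmA -jd -pa_cmpmA (pa_cmpmA (dif P _)) dif_dif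
    pa_cmp0m pa_cmpm0.
exists (Complex dd), (@ChainMap _ (Complex dd) P j jd), r.
by split=> n; have [] := QjP n.
Qed.

Variables (Q : complex A) (j : chain_map Q P).
Variable (r : forall n, pa_mor (cx P n) (cx Q n)).
Hypothesis rj : forall n, r n ∙ cm j n = pa_id _.
Hypothesis jr : forall n, m <= n -> cm j n ∙ r n = pa_id _.
Variable V : complex A.
Hypothesis V0 : forall n, n <= m -> is_zero_obj (cx V n).

(** Extension by zero below [m]. The one critical square leaves degree [m - 1] and ends in degree
    [m], which is why [V] has to vanish in degree [m] itself. *)
Lemma brutal_extension (v : chain_map Q V) :
  exists w : chain_map P V, chain_cmp w j = v.
Proof.
have wP n : dif V n ∙ (cm v n ∙ r n) = cm v (n + 1) ∙ r (n + 1) ∙ dif P n.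
  have [le_mn|lt_nm] := leP m n; last by apply: (V0 _).2; lia.
  rewrite -[RHS]pa_cmpm1 -(jr le_mn) -!pa_cmpmA (pa_cmpmA (dif P _)) cm_dif.
  by rewrite !pa_cmpmA -(pa_cmpmA (cm v _)) rj pa_cmpm1 cm_dif.
exists (@ChainMap _ P V _ wP); apply: chain_map_eq => n /=.
by rewrite -pa_cmpmA rj pa_cmpm1.
Qed.

Lemma brutal_homotopic (a b : chain_map P V) :
  homotopic (chain_cmp a j) (chain_cmp b j) -> homotopic a b.
Proof.
move=> [h hE]; exists (fun n => h n ∙ r (n + 1)) => n.
have [le_mn|lt_nm] := leP m (n + 1); last by apply: (V0 _).2; lia.
rewrite -[LHS]pa_cmpm1 -[RHS]pa_cmpm1 -(jr le_mn) !pa_cmpmA; congr (_ ∙ _).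
rewrite pa_cmpBl (hE n) pa_cmpDl -!pa_cmpmA rj pa_cmpm1 cm_dif.
by rewrite (pa_cmpmA (r _)) rj pa_cmp1m.
Qed.

End BrutalTruncation.

End Resolution.

(** * The case of enough projectives *)

Section FiniteResolution.
Variable A : abelian.

Local Notation expr := (@loc_expr (Cb A) (@Cb_quasi_iso A)).
Implicit Types X Y Z : bcomplex A.

Lemma loc_act_precmp (P Q : complex A) (j : chain_map Q P) X Y (e : expr X Y)
    (a : chain_map P X) (b : chain_map P Y) :
  loc_act e a b -> loc_act e (chain_cmp a j) (chain_cmp b j).
Proof.
elim: e a b => {X Y} [X Y f|X Y s qs|X Y Z g IHg f IHf] /= a b.
- by rewrite chain_cmpA => ab; apply: homotopic_cmp ab (homotopic_refl _).
- by rewrite chain_cmpA => ab; apply: homotopic_cmp ab (homotopic_refl _).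
- by move=> [c [/IHf ac /IHg cb]]; exists (chain_cmp c j).
Qed.

(* A form of the faithfulness of [Hom_K(P, -)] on maps out of [P], where [P] is
   replaced by its truncations, which are objects of the derived category. *)
Lemma loc_act_truncation (P : complex A) X Y (e : expr X Y) :
  exists L : int, forall l (T : bcomplex A) (q : chain_map P T),
    l <= L -> is_truncation l q ->
    forall (a : chain_map T X) (b : chain_map T Y),
    loc_act e (chain_cmp a q) (chain_cmp b q) ->
    @cmp (Db A) T X Y (loc_class e) (@fmap _ _ (toDb A) T X a)
    = @fmap _ _ (toDb A) T Y b.
Proof.
elim: e => {X Y} [X Y f|X Y s qs|X Y Z g [Lg IHg] f [Lf IHf]].
- have [N Y0] := bounded_above Y; exists (- N%:Z) => l T q le_lN qT a b ab.
  have {}ab : homotopic (chain_cmp (chain_cmp f a) q) (chain_cmp b q).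
    by rewrite -chain_cmpA.
  have Yl n : n < l -> is_zero_obj (cx Y n) by move=> ?; apply: Y0; lia.
  apply: etrans (homotopic_Db (truncation_homotopic qT Yl ab)).
  exact: esym (@fmapM _ _ (toDb A) T X Y f a).
- have [N Y0] := bounded_above Y; exists (- N%:Z) => l T q le_lN qT a b ab.
  have {}ab : homotopic (chain_cmp a q) (chain_cmp (chain_cmp s b) q).
    by rewrite -chain_cmpA.
  have Yl n : n < l -> is_zero_obj (cx Y n) by move=> ?; apply: Y0; lia.
  have sVs : @cmp (Db A) X Y X (loc_class (LInv qs))
      (@fmap _ _ (toDb A) X Y s) = @idm (Db A) X.
    exact: loc_invK.
  apply: etrans (@cmp1m (Db A) T X _); rewrite -sVs -cmpmA; congr (_ ∘ _).
  apply: etrans (homotopic_Db (truncation_homotopic qT Yl ab)) _.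
  exact: (@fmapM _ _ (toDb A) T X Y s b).
- have [N Y0] := bounded_above Y.
  (* The bound also lies below the middle complex [Y], so that the intermediate chain map [c]
     descends to [T]. *)
  exists (Num.min (- N%:Z) (Num.min Lg Lf)) => l T q.
  rewrite !le_min => /and3P[le_lN le_lg le_lf] qT a b [c [ac cb]].
  have Yl n : n < l -> is_zero_obj (cx Y n) by move=> ?; apply: Y0; lia.
  have [c' c'E] := truncation_factor qT Yl c; rewrite -c'E in ac cb.
  rewrite loc_class_cmp; apply: etrans (IHg _ _ _ le_lg qT _ _ cb).
  apply: etrans (esym (@cmpmA (Db A) T X Y Z _ _ _)) _; congr (_ ∘ _).
  exact: IHf _ _ _ le_lf qT _ _ ac.
Qed.

Section Retract.
Variables (Z : bcomplex A) (P : complex A) (p : chain_map P Z) (N : nat).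
Hypothesis P_proj : forall n, @projective A (cx P n).
Hypothesis P0 : forall n, N%:Z < n -> is_zero_obj (cx P n).
Hypothesis Z0 : forall n, n < - N%:Z \/ N%:Z < n -> is_zero_obj (cx Z n).
Hypothesis rp : resolves p.

Lemma truncation_resolution l : l <= - N%:Z ->
  exists (T : bcomplex A) (q : chain_map P T) (s : chain_map T Z),
  [/\ is_truncation l q, chain_cmp s q = p & quasi_iso s].
Proof.
move=> le_lN; have [T [q qT]] := truncation_exists P l.
have [|s sE] := @truncation_factor _ _ _ _ _ qT Z _ p.
  by move=> n lt_nl; apply: Z0; lia.
exists (BComplex (truncation_bounded qT P0)), q, s; split=> //.
exact: truncation_quasi_iso qT rp sE.
Qed.

Variables (m : int) (Q : bcomplex A) (j : chain_map Q P).
Hypothesis lt_mN : m < - N%:Z.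
Hypothesis Q0 : forall n, n < m -> is_zero_obj (cx Q n).

(* If [p j] splits, then [P] is homotopy equivalent to a direct summand of [Q],
   which splits the differentials of [P] in low degrees. *)
Lemma finite_resolution_of_retract :
  is_retraction (@fmap _ _ (toDb A) Q Z (chain_cmp p j)) ->
  has_finite_projective_resolution Z.
Proof.
move=> [s ps].
have [b sb] := loc_act_total P_proj P0 (loc_repr s) p.
have pjb : homotopic (chain_cmp p (chain_id P)) (chain_cmp p (chain_cmp j b)).
  rewrite chain_cmpm1 chain_cmpA; apply/(act_id P_proj P0); rewrite -ps.
  apply/(act_cmp P_proj P0); exists b; split=> //.
  by apply/(act_toDb P_proj P0); apply: homotopic_refl.
have [h hE] := lift_unique P_proj P0 (resolves_quasi_iso rp) pjb.
(* In degree [m - 1], just below [Q], the composite [j b] is zero, so [1 = d h + h d] on [P]. There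
   [h d] factors as [r q], and [q d = 0] gives [q r q = q]: the lowest term of [T] is a direct
   summand of that of [P]. *)
have [|T [q [t [qT tq qt]]]] := @truncation_resolution (m - 1); first by lia.
exists T, t; split=> // n; have [qe qn _] := qT n.
have [lt_nm|lt_mn|nm] := ltgtP n (m - 1).
- exact/projective_zero/(truncation_zero qT).
- have [r rq] := truncation_retract qT lt_mn.
  apply: (@projective_section _ _ _ (cm q n) r) => //.
  by apply: qe => /=; rewrite -pa_cmpmA rq pa_cmpm1 pa_cmp1m.
elim/int_succ_case: n qe qn nm => n qe [_ /(_ n erefl)/= qd] nm.
have [_ _ qU] := qT (n + 1).
have [|r rq] := qU _ (h (n + 1) ∙ dif P (n + 1)).
  apply: truncatableS => [lt_nm|_]; first by exfalso; lia.
  by rewrite -pa_cmpmA dif_dif pa_cmpm0.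
apply: (@projective_section _ _ _ (cm q (n + 1)) r) => //; apply: qe => /=.
rewrite -pa_cmpmA rq pa_cmp1m.
have -> : h (n + 1) ∙ dif P (n + 1) = pa_id _ - dif P n ∙ h n.
  have jb0 : cm j (n + 1) ∙ cm b (n + 1) = 0.
    by rewrite (zero_to (cm b (n + 1))) ?pa_cmpm0 //; apply: Q0; lia.
  have := hE n; rewrite /= jb0 subr0 => ->.
  by rewrite [X in _ = X - _]addrC addrK.
by rewrite pa_cmpBr pa_cmpm1 pa_cmpmA qd // pa_cmp0m subr0.
Qed.

End Retract.

(** The almost split condition is asked for chain maps [u] only. This is the form that can be
    checked for the reversed morphism over the opposite category. *)
Theorem finite_projective_resolution (Y Z : bcomplex A) (g : @mor (Db A) Y Z) :
  enough_projectives A -> ~ is_retraction g ->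
  (forall (Q : bcomplex A) (u : chain_map Q Z),
    is_retraction (@fmap _ _ (toDb A) Q Z u) \/
    exists v : @mor (Db A) Q Y, g ∘ v = @fmap _ _ (toDb A) Q Z u) ->
  has_finite_projective_resolution Z.
Proof.
move=> enough gN ras.
have [NY Y0] := bounded_above Y; have [NZ Z0'] := bounded_above Z.
(* With this [m], both [Y] and [Z] vanish in all degrees [<= m], including [m]. *)
pose N := maxn NY NZ; pose m := - N%:Z - 1.
have Z0 n : n < - N%:Z \/ N%:Z < n -> is_zero_obj (cx Z n).
  by move=> ?; apply: Z0'; lia.
have [|P [p [P_proj P0 rp]]] := @projective_resolution A Z N enough.
  by move=> n ?; apply: Z0; right.
have [Q [j [r [rj jr Q0]]]] := brutal_truncation P m.
have Q0' n : N%:Z < n -> is_zero_obj (cx Q n).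
  by move=> /P0 Pn0; apply/zero_objP; rewrite -rj (Pn0.2 _ (cm j n) 0) pa_cmpm0.
have Q_bounded : bounded Q.
  exists N.+1 => n lt_n.
  by have [/Q0//|/Q0'] : n < m \/ N%:Z < n by lia.
have Q_proj n : @projective A (cx Q n) by exact: projective_section (rj n).
have [|[v gv]] := ras (BComplex Q_bounded) (chain_cmp p j).
  apply: (@finite_resolution_of_retract Z P p N P_proj P0 Z0 rp m
    (BComplex Q_bounded) j _ Q0); lia.
(* As [Q] has projective terms, [v] is represented by a chain map [v0], which extends to [w] on [P].
   The image of [w] under [g] is homotopic to [p], because this holds after restriction to [Q]. *)
case: gN.
have [v0 v0E] := @loc_act_total _ _ _ Q_proj Q0' _ _ (loc_repr v) (chain_id Q).
have [w wj] : exists w : chain_map P Y, chain_cmp w j = v0.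
  by apply: (brutal_extension rj jr) => n ?; apply: Y0; lia.
have [c cE] := loc_act_total P_proj P0 (loc_repr g) w.
have cp : homotopic c p.
  apply: (brutal_homotopic rj jr) => [n ?|]; first by apply: Z0; lia.
  have gvc : act (g ∘ v) (chain_id Q) (chain_cmp c j).
    apply/(act_cmp Q_proj Q0'); exists v0; split=> //; rewrite -wj.
    exact: loc_act_precmp cE.
  rewrite gv in gvc; move/(act_toDb Q_proj Q0'): gvc.
  by rewrite chain_cmpm1; apply: homotopic_sym.
have {cE cp} gwp := loc_act_homotopic (homotopic_refl w) cp cE.
(* On a low enough truncation [T], the composite of [g] with [w'] equals the quasi-isomorphism [s]
   in [Db A]; inverting [s] yields a section of [g]. *)
have [L LP] := loc_act_truncation P (loc_repr g).
have [|T [q [s [qT sq qs]]]] := truncation_resolution P0 Z0 rp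
  (l := Num.min L (- N%:Z)); first by rewrite ge_min lexx orbT.
have [|w' w'q] := truncation_factor qT (V := Y) _ w.
  by move=> n lt_n; apply: Y0; lia.
rewrite -w'q -sq in gwp.
have gw's := LP _ _ _ _ qT _ _ gwp; rewrite loc_reprK in gw's.
have [t [_ st]] := quasi_iso_Db qs.
exists (@fmap _ _ (toDb A) T Y w' ∘ t).
by rewrite cmpmA gw's ?ge_min ?lexx.
Qed.

End FiniteResolution.

(** * The opposite category *)

Record cofunctor (C D : category) := Cofunctor {
  cobj :> C -> D;
  cmap : forall X Y : C, mor X Y -> mor (cobj Y) (cobj X);
  cmap1 : forall X : C, cmap (idm X) = idm (cobj X);
  cmapM : forall (X Y Z : C) (g : mor Y Z) (f : mor X Y),
    cmap (g ∘ f) = cmap f ∘ cmap g }.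

Arguments cmap {C D} F {X Y} f : rename.

Section ContravariantLocalization.
Variables (C D : category).
Variables (W : forall X Y : C, mor X Y -> Prop).
Variables (W' : forall X Y : D, mor X Y -> Prop).
Variable F : cofunctor C D.
Hypothesis FW : forall (X Y : C) (s : mor X Y), W s -> W' (cmap F s).

Fixpoint loc_expr_op X Y (e : loc_expr W X Y) : loc_expr W' (F Y) (F X) :=
  match e with
  | LMor _ _ f => LMor W' (cmap F f)
  | LInv _ _ _ Ws => LInv (FW Ws)
  | LCmp _ _ _ g f => LCmp (loc_expr_op f) (loc_expr_op g)
  end.

Lemma loc_eq_op X Y (e1 e2 : loc_expr W X Y) :
  loc_eq e1 e2 -> loc_eq (loc_expr_op e1) (loc_expr_op e2).
Proof.
elim=> {X Y e1 e2} /= *; rewrite ?cmap1 ?cmapM.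
- exact: loc_eq_refl.
- exact: loc_eq_sym.
- by apply: loc_eq_trans; eassumption.
- exact: loc_eq_cmp.
- exact: loc_eq_m1.
- exact: loc_eq_1m.
- exact/loc_eq_sym/loc_eq_mA.
- exact: loc_eq_mor.
- exact: loc_eq_mV.
- exact: loc_eq_Vm.
Qed.

Definition loc_op X Y (f : @mor (localization W) X Y) :
    @mor (localization W') (F Y) (F X) :=
  loc_class (loc_expr_op (loc_repr f)).

Lemma loc_op_class X Y (e : loc_expr W X Y) :
  loc_op (loc_class e) = loc_class (loc_expr_op e).
Proof. exact/loc_classP/loc_eq_op/loc_repr_class. Qed.

Lemma loc_op_mor X Y (f : mor X Y) :
  loc_op (fmap (loc_functor W) f) = fmap (loc_functor W') (cmap F f).
Proof. exact: loc_op_class. Qed.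

Lemma loc_op1 X :
  loc_op (@idm (localization W) X) = @idm (localization W') (F X).
Proof. by rewrite -(fmap1 (loc_functor W)) loc_op_mor cmap1 fmap1. Qed.

Lemma loc_opM X Y Z (g : @mor (localization W) Y Z)
    (f : @mor (localization W) X Y) :
  loc_op (g ∘ f) = loc_op f ∘ loc_op g.
Proof.
rewrite [LHS]loc_op_class; apply/loc_classP/loc_eq_sym.
by apply: loc_eq_cmp; apply: loc_repr_class.
Qed.

End ContravariantLocalization.

Program Definition op_preadditive (A : preadditive) : preadditive :=
  @Preadditive (pa_obj A) (fun X Y => @pa_mor A Y X) (@pa_id A)
    (fun X Y Z g f => f ∙ g) _ _ _ _ _.
Next Obligation. by move=> A X Y f; apply: pa_cmpm1. Qed.
Next Obligation. by move=> A X Y f; apply: pa_cmp1m. Qed.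
Next Obligation. by move=> A X Y Z T h g f; apply: esym (pa_cmpmA _ _ _). Qed.
Next Obligation. by move=> A X Y Z g h f; apply: pa_cmpDr. Qed.
Next Obligation. by move=> A X Y Z g f h; apply: pa_cmpDl. Qed.

Program Definition op (A : abelian) : abelian :=
  @Abelian (op_preadditive A) _
    (fun X Y => let B := ab_biproduct X Y in
      @Biproduct (op_preadditive A) X Y (bip B) (pr1 B) (pr2 B) (in1 B) (in2 B)
        (pr1_in1 B) (pr2_in2 B) (pr2_in1 B) (pr1_in2 B) (in_pr B)) _ _ _ _.
Next Obligation. by move=> A; have [Z [Z1 Z2]] := ab_zero A; exists Z. Qed.
Next Obligation. by move=> A X Y f; exact: (@ab_cokernel A Y X f). Qed.
Next Obligation. by move=> A X Y f; exact: (@ab_kernel A Y X f). Qed.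
Next Obligation. by move=> A X Y f; exact: (@ab_epi_conormal A Y X f). Qed.
Next Obligation. by move=> A X Y f; exact: (@ab_mono_normal A Y X f). Qed.

Section OppositeHomology.
Variable A : abelian.

(* In both proofs the required cover in the opposite category is the pushout of
   the data; that it is a monomorphism follows from the assumption. *)
Lemma hom_inj_op (V W U' V' W' : pa_obj A) (b : pa_mor V W) (a' : pa_mor U' V')
    (b' : pa_mor V' W') (v : pa_mor V V') :
  hom_surj b a' b' v -> @hom_inj (op A) W' V' U' W V b' a' b v.
Proof.
move=> vs; suff H : forall T (x : pa_mor V' T) (y : pa_mor W T),
    x ∙ a' = 0 -> x ∙ v = y ∙ b ->
    exists T' (e : pa_mor T T') (u : pa_mor W' T'),
      @is_mono A _ _ e /\ u ∙ b' = e ∙ x by exact: H.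
move=> T x y xa xv; pose B := ab_biproduct T W'.
have [T' [c cC]] := ab_cokernel (pairm B x (- b')).
exists T', (c ∙ in1 B), (c ∙ in2 B); split; last first.
  apply/eqP; rewrite eq_sym -subr_eq0; apply/eqP; rewrite -[RHS]cC.1 /=.
  by rewrite pa_cmpDr pa_cmpmN pa_cmpmN !pa_cmpmA.
apply/monoP => S t; rewrite -pa_cmpmA => ct.
have [S1 [e1 [z [ee1 zE]]]] := cokernel_cover cC ct.
have := congr1 (pa_cmp (pr1 B)) zE; have := congr1 (pa_cmp (pr2 B)) zE.
rewrite !pa_cmpmA pr1_pairm pr2_pairm pr1_in1 pr2_in1 pa_cmp1m !pa_cmp0m.
rewrite pa_cmpNm => /eqP; rewrite oppr_eq0 => /eqP bz xz.
(* On a cover, [z] is the image of a cycle plus a boundary. The boundary is killed by [x], and so is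
   the image of the cycle, because [x ∙ v = y ∙ b]. *)
have [S2 [e2 [x0 [w [ee2 bx0 x0E]]]]] := vs _ z bz.
move/epiP: (epi_cmp ee1 ee2); apply.
rewrite pa_cmpmA -xz -pa_cmpmA -x0E pa_cmpDr !pa_cmpmA.
by rewrite xv xa -pa_cmpmA bx0 pa_cmpm0 pa_cmp0m addr0.
Qed.

Lemma hom_surj_op (U V W U' V' : pa_obj A) (a : pa_mor U V) (b : pa_mor V W)
    (a' : pa_mor U' V') (v : pa_mor V V') :
  hom_inj a b a' v -> @hom_surj (op A) V' U' W V U a' b a v.
Proof.
move=> vi; suff H : forall T (y : pa_mor V T), y ∙ a = 0 ->
    exists T' (e : pa_mor T T') (x : pa_mor V' T') (u : pa_mor W T'),
      [/\ @is_mono A _ _ e, x ∙ a' = 0 & x ∙ v + u ∙ b = e ∙ y] by exact: H.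
move=> T y ya; pose B1 := ab_biproduct V' W.
pose B := ab_biproduct T (bip B1).
pose C := ab_biproduct V U'.
(* In elements, [phi] sends [p, q] to [y p, - v p + a' q, - b p]. Its cokernel imposes exactly
   [e ∙ y = x ∙ v + u ∙ b] and [x ∙ a' = 0] on the three components. *)
pose phi := copairm C (pairm B y (- pairm B1 v b)) (pairm B 0 (pairm B1 a' 0)).
have [T' [c cC]] := ab_cokernel phi.
exists T', (c ∙ in1 B), (c ∙ in2 B ∙ in1 B1), (c ∙ in2 B ∙ in2 B1); split.
- apply/monoP => S t; rewrite -pa_cmpmA => ct.
  have [S1 [e1 [z [ee1 zE]]]] := cokernel_cover cC ct.
  have phiE : phi ∙ z = pairm B (y ∙ (pr1 C ∙ z))
      (pairm B1 (- (v ∙ (pr1 C ∙ z)) + a' ∙ (pr2 C ∙ z)) (- (b ∙ (pr1 C ∙ z)))).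
    rewrite /phi /copairm pa_cmpDl -!pa_cmpmA.
    apply: biprod_ext.
      by rewrite pa_cmpDr !pa_cmpmA !pr1_pairm !pa_cmp0m addr0.
    rewrite pa_cmpDr !pa_cmpmA !pr2_pairm; apply: biprod_ext.
      by rewrite pa_cmpDr !pa_cmpmA pa_cmpmN !pr1_pairm !pa_cmpNm.
    by rewrite pa_cmpDr !pa_cmpmA pa_cmpmN !pr2_pairm !pa_cmpNm !pa_cmp0m addr0.
  rewrite phiE in zE.
  have yz : y ∙ (pr1 C ∙ z) = t ∙ e1.
    have := congr1 (pa_cmp (pr1 B)) zE.
    by rewrite pr1_pairm !pa_cmpmA pr1_in1 pa_cmp1m.
  have := congr1 (pa_cmp (pr2 B)) zE.
  rewrite pr2_pairm !pa_cmpmA pr2_in1 !pa_cmp0m => z0.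
  have bz : b ∙ (pr1 C ∙ z) = 0.
    have := congr1 (pa_cmp (pr2 B1)) z0; rewrite pr2_pairm pa_cmpm0 => /eqP.
    by rewrite oppr_eq0 pa_cmpmA => /eqP.
  have vz : v ∙ (pr1 C ∙ z) = a' ∙ (pr2 C ∙ z).
    have := congr1 (pa_cmp (pr1 B1)) z0; rewrite pr1_pairm pa_cmpm0 addrC.
    by move=> /eqP; rewrite subr_eq0 !pa_cmpmA => /eqP.
  have [S2 [e2 [u [ee2 uE]]]] := vi _ _ _ bz vz.
  move/epiP: (epi_cmp ee1 ee2); apply.
  by rewrite pa_cmpmA -yz -pa_cmpmA -uE pa_cmpmA ya pa_cmp0m.
- have := congr1 (pa_cmp^~ (in2 C)) cC.1.
  rewrite /= -pa_cmpmA copairm_in2 pa_cmp0m {1}/pairm pa_cmpm0 add0r.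
  by rewrite {1}/pairm pa_cmpm0 addr0 !pa_cmpmA.
- have := congr1 (pa_cmp^~ (in1 C)) cC.1.
  rewrite /= -pa_cmpmA copairm_in1 pa_cmp0m {1}/pairm pa_cmpDr !pa_cmpmN.
  move=> /eqP; rewrite subr_eq0 => /eqP; rewrite pa_cmpmA => ->.
  by rewrite /pairm !pa_cmpDr !pa_cmpmA.
Qed.

End OppositeHomology.

(** * Complexes over the opposite category *)

Section OppositeComplex.
Variable A : abelian.

Lemma opp_succ (n : int) : - (n + 1) + 1 = - n.
Proof. by rewrite opprD subrK. Qed.

Program Definition op_complex (X : complex A) : complex (op A) :=
  @Complex (op A) (fun n => cx X (- n)) (fun n => xdif X (opp_succ n)) _.
Next Obligation. by move=> X n; apply: xdif_xdif. Qed.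

Program Definition op_map (X Y : complex A) (f : chain_map X Y) :
    chain_map (op_complex Y) (op_complex X) :=
  @ChainMap (op A) (op_complex Y) (op_complex X) (fun n => cm f (- n)) _.
Next Obligation. by move=> X Y f n; apply: esym (cm_xdif f (opp_succ n)). Qed.

Lemma op_xdif (X : complex A) k n (e : k + 1 = n) (e' : - n + 1 = - k) :
  xdif (op_complex X) e = xdif X e'.
Proof. by case: n / e e' => e'; rewrite (eq_irrelevance e' (opp_succ k)). Qed.

Lemma op_xcast (X : complex A) m n (e : m = n) (e' : - n = - m) :
  xcast (op_complex X) e = xcast X e'.
Proof. by case: n / e e' => e'; apply: esym (xcastE _ e'). Qed.

Lemma bounded_op (X : complex A) : bounded X -> bounded (op_complex X).
Proof.
move=> [N X0]; exists N => n ltNn; have [|H1 H2] := X0 (- n); first by lia.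
by split.
Qed.

Definition op_bcomplex (X : bcomplex A) : bcomplex (op A) :=
  BComplex (bounded_op (bcx_bounded X)).

Lemma quasi_iso_op (X Y : complex A) (f : chain_map X Y) :
  quasi_iso f -> quasi_iso (op_map f).
Proof.
move=> /quasi_isoP qf.
have qx k m n (e : k + 1 = m) (e' : m + 1 = n) :
    hom_inj (xdif X e) (xdif X e') (xdif Y e) (cm f m) /\
    hom_surj (xdif X e') (xdif Y e) (xdif Y e') (cm f m).
  by case: n / e'; case: m / e; apply: qf.
apply/quasi_isoP => n; have [fi fs] := qx _ _ _ (opp_succ (n + 1)) (opp_succ n).
by split; [apply: hom_inj_op fs | apply: hom_surj_op fi].
Qed.

(* The terms and conditions of a complex over [op (op A)] are convertible to
   those of a complex over [A], although [op (op A)] is not convertible to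
   [A]. *)
Definition op_op (X : complex (op (op A))) : complex A :=
  @Complex A (cx X) (dif X) (dif_dif X).

Definition op_op_map (X Y : complex (op (op A))) (f : chain_map X Y) :
    chain_map (op_op X) (op_op Y) :=
  @ChainMap A (op_op X) (op_op Y) (cm f) (cm_dif f).

Lemma quasi_iso_op_op (X Y : complex (op (op A))) (f : chain_map X Y) :
  quasi_iso f -> quasi_iso (op_op_map f).
Proof. by move=> /quasi_isoP qf; apply/quasi_isoP => n; apply: qf. Qed.

End OppositeComplex.

Section UnopComplex.
Variable A : abelian.

Definition unop_complex (M : complex (op A)) : complex A :=
  op_op (op_complex M).

Definition unop_map (M M' : complex (op A)) (u : chain_map M M') :
    chain_map (unop_complex M') (unop_complex M) := op_op_map (op_map u).

Lemma bounded_unop (M : complex (op A)) : bounded M -> bounded (unop_complex M).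
Proof. exact: (@bounded_op (op A)). Qed.

Definition unop_bcomplex (M : bcomplex (op A)) : bcomplex A :=
  BComplex (bounded_unop (bcx_bounded M)).

Lemma quasi_iso_unop (M M' : complex (op A)) (u : chain_map M M') :
  quasi_iso u -> quasi_iso (unop_map u).
Proof. by move=> qu; apply/quasi_iso_op_op/quasi_iso_op. Qed.

Lemma unop_xdif (M : complex (op A)) k n (e : k + 1 = n) (e' : - n + 1 = - k) :
  xdif (unop_complex M) e = xdif M e'.
Proof. by case: n / e e' => e'; rewrite (eq_irrelevance e' (opp_succ k)). Qed.

Lemma opp_opp_succ (n : int) : - - n + 1 = - - (n + 1).
Proof. by rewrite !opprK. Qed.

Lemma unop_op_dif (X : complex A) n :
  dif (unop_complex (op_complex X)) n = xdif X (opp_opp_succ n).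
Proof. by apply: op_xdif. Qed.

Lemma op_unop_dif (M : complex (op A)) n :
  dif (op_complex (unop_complex M)) n = xdif M (opp_opp_succ n).
Proof. by apply: unop_xdif. Qed.

Program Definition unop_op (X : complex A) :
    chain_map X (unop_complex (op_complex X)) :=
  @ChainMap A X (unop_complex (op_complex X))
    (fun n => xcast X (esym (opprK n))) _.
Next Obligation.
move=> X n; rewrite unop_op_dif; have e : n + 1 = - - (n + 1) by rewrite opprK.
rewrite -(xdifE X (erefl (n + 1))).
exact: etrans (xdif_xcast _ _ _ e) (esym (xcast_xdif _ _ _ e)).
Qed.

Program Definition unop_op_inv (X : complex A) :
    chain_map (unop_complex (op_complex X)) X :=
  @ChainMap A (unop_complex (op_complex X)) X (fun n => xcast X (opprK n)) _.
Next Obligation.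
move=> X n; rewrite unop_op_dif; have e : - - n + 1 = n + 1 by rewrite opprK.
rewrite -(xdifE X (erefl (n + 1))).
exact: etrans (xdif_xcast _ _ _ e) (esym (xcast_xdif _ _ _ e)).
Qed.

Lemma unop_opK (X : complex A) :
  chain_cmp (unop_op_inv X) (unop_op X) = chain_id X.
Proof. by apply: chain_map_eq => n /=; rewrite xcast_cmp // xcastE. Qed.

Lemma unop_opKV (X : complex A) :
  chain_cmp (unop_op X) (unop_op_inv X) = chain_id _.
Proof. by apply: chain_map_eq => n /=; rewrite xcast_cmp // xcastE. Qed.

Program Definition op_unop (M : complex (op A)) :
    chain_map M (op_complex (unop_complex M)) :=
  @ChainMap (op A) M (op_complex (unop_complex M))
    (fun n => xcast M (esym (opprK n))) _.
Next Obligation.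
move=> X n; rewrite op_unop_dif; have e : n + 1 = - - (n + 1) by rewrite opprK.
rewrite -(xdifE X (erefl (n + 1))).
exact: etrans (xdif_xcast _ _ _ e) (esym (xcast_xdif _ _ _ e)).
Qed.

Program Definition op_unop_inv (M : complex (op A)) :
    chain_map (op_complex (unop_complex M)) M :=
  @ChainMap (op A) (op_complex (unop_complex M)) M
    (fun n => xcast M (opprK n)) _.
Next Obligation.
move=> X n; rewrite op_unop_dif; have e : - - n + 1 = n + 1 by rewrite opprK.
rewrite -(xdifE X (erefl (n + 1))).
exact: etrans (xdif_xcast _ _ _ e) (esym (xcast_xdif _ _ _ e)).
Qed.

End UnopComplex.

Section OppositeDerived.
Variable A : abelian.

Definition unop_adjoint (M : complex (op A)) (X : complex A)
    (u : chain_map M (op_complex X)) : chain_map X (unop_complex M) :=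
  chain_cmp (unop_map u) (unop_op X).

Lemma op_unop_adjoint (M : complex (op A)) (X : complex A)
    (u : chain_map M (op_complex X)) :
  chain_cmp (op_map (unop_adjoint u)) (op_unop M) = u.
Proof.
apply: chain_map_eq => n; set e := esym (opprK n).
have e' : - - - n = - n by rewrite opprK.
have -> : cm (chain_cmp (op_map (unop_adjoint u)) (op_unop M)) n =
    @pa_cmp A _ _ _ (cm u (- - n) ∙ xcast M e) (xcast X (esym (opprK (- n)))).
  exact: (@pa_cmpmA A).
rewrite (cm_xcast u e) (op_xcast X e e').
by apply: etrans (esym (@pa_cmpmA A _ _ _ _ _ _ _)) _;
  rewrite xcast_cmp // xcastE pa_cmpm1.
Qed.

Lemma unop_adjoint_inv (M : complex (op A)) (X : complex A)
    (u : chain_map M (op_complex X)) :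
  chain_cmp u (op_unop_inv M) = op_map (unop_adjoint u).
Proof.
apply: chain_map_eq => n; have := cm_xcast u (opprK n).
by rewrite (op_xcast X (opprK n) (esym (opprK (- n)))).
Qed.

Lemma unop_op_nat (X Y : complex A) (f : chain_map X Y) :
  chain_cmp (unop_map (op_map f)) (unop_op X) = chain_cmp (unop_op Y) f.
Proof. by apply: chain_map_eq => n; exact: (cm_xcast f (esym (opprK n))). Qed.

Lemma quasi_iso_unop_adjoint (M : complex (op A)) (X : complex A)
    (u : chain_map M (op_complex X)) :
  quasi_iso u -> quasi_iso (unop_adjoint u).
Proof.
move=> /quasi_iso_unop/quasi_isoP qu; apply/quasi_isoP => n.
have [ui us] := qu n; pose eta := unop_op X; pose eta' := unop_op_inv X.
have eK k : cm eta' k ∙ cm eta k = pa_id _.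
  exact: (congr1 (fun f => cm f k) (unop_opK X)).
have eKV k : cm eta k ∙ cm eta' k = pa_id _.
  exact: (congr1 (fun f => cm f k) (unop_opKV X)).
split=> [T x y dx ux|T y dy].
  have [||T' [e [v [ee vE]]]] := ui T (cm eta (n + 1) ∙ x) y.
  - by rewrite pa_cmpmA cm_dif -pa_cmpmA dx pa_cmpm0.
  - by rewrite -ux -pa_cmpmA.
  exists T', e, (cm eta' n ∙ v); split=> //.
  by rewrite pa_cmpmA cm_dif -pa_cmpmA vE !pa_cmpmA eK pa_cmp1m.
have [T' [e [x [v [ee dx xE]]]]] := us T y dy.
exists T', e, (cm eta' (n + 1) ∙ x), v; split=> //.
  by rewrite pa_cmpmA cm_dif -pa_cmpmA dx pa_cmpm0.
rewrite -xE; congr (_ + _); apply: etrans (pa_cmpmA _ _ _) _.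
congr (_ ∙ x); apply: etrans (esym (pa_cmpmA _ _ _)) _.
by apply: etrans (congr1 (pa_cmp _) (eKV _)) _; rewrite pa_cmpm1.
Qed.

Program Definition Cb_op : cofunctor (Cb A) (Cb (op A)) :=
  @Cofunctor (Cb A) (Cb (op A)) (@op_bcomplex A)
    (fun X Y f => @op_map A X Y f) _ _.
Next Obligation. by move=> X; apply: chain_map_eq. Qed.
Next Obligation. by move=> X Y Z g f; apply: chain_map_eq. Qed.

Program Definition Cb_unop : cofunctor (Cb (op A)) (Cb A) :=
  @Cofunctor (Cb (op A)) (Cb A) (@unop_bcomplex A)
    (fun M M' u => @unop_map A M M' u) _ _.
Next Obligation. by move=> X; apply: chain_map_eq. Qed.
Next Obligation. by move=> X Y Z g f; apply: chain_map_eq. Qed.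

Lemma Cb_op_quasi_iso (X Y : Cb A) (s : mor X Y) :
  Cb_quasi_iso s -> Cb_quasi_iso (cmap Cb_op s).
Proof. exact: quasi_iso_op. Qed.

Lemma Cb_unop_quasi_iso (M M' : Cb (op A)) (s : mor M M') :
  Cb_quasi_iso s -> Cb_quasi_iso (cmap Cb_unop s).
Proof. exact: quasi_iso_unop. Qed.

Local Notation Db_op := (loc_op Cb_op_quasi_iso).
Local Notation Db_unop := (loc_op Cb_unop_quasi_iso).

Definition Cb_eta (X : Cb A) : mor X (Cb_unop (Cb_op X)) :=
  unop_op (X : bcomplex A).

(** Induction on expressions: the square of a quasi-isomorphism, multiplied by inverses on both
    sides, is the square of its formal inverse, and squares compose. *)
Lemma Db_eta_nat (X Y : Db A) (f : mor X Y) :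
  Db_unop (Db_op f) ∘ fmap (toDb A) (Cb_eta X) = fmap (toDb A) (Cb_eta Y) ∘ f.
Proof.
have nat_mor (U V : Cb A) (u : mor U V) :
    Db_unop (Db_op (fmap (toDb A) u)) ∘ fmap (toDb A) (Cb_eta U)
    = fmap (toDb A) (Cb_eta V) ∘ fmap (toDb A) u.
  by rewrite !loc_op_mor -!fmapM; congr (fmap _ _); apply: unop_op_nat.
rewrite -(loc_reprK f); elim: (loc_repr f) => {X Y f}.
- exact: nat_mor.
- move=> X Y s qs; pose t : @mor (Db A) Y X := loc_class (LInv qs).
  have ts : t ∘ fmap (toDb A) s = @idm (Db A) X := loc_invK qs.
  have st : fmap (toDb A) s ∘ t = @idm (Db A) Y := loc_invKV qs.
  rewrite -/t -[LHS]cmpm1 -st cmpmA -(cmpmA _ _ (fmap _ s)) -nat_mor cmpmA.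
  by rewrite -!loc_opM ts !loc_op1 cmp1m.
- move=> X Y Z g IHg h IHh; rewrite loc_class_cmp !loc_opM.
  by rewrite -cmpmA IHh !cmpmA IHg.
Qed.

Lemma Db_eta_iso (X : Db A) : is_iso (fmap (toDb A) (Cb_eta X)).
Proof.
pose u : mor (Cb_unop (Cb_op X)) X := unop_op_inv (X : bcomplex A).
exists (fmap (toDb A) u).
split; rewrite -fmapM -fmap1; congr (fmap _ _).
  exact: unop_opK.
exact: unop_opKV.
Qed.

(** Reversing twice returns [f] up to the isomorphisms [Cb_eta], so a right inverse of [Db_op f],
    reversed and conjugated, is a left inverse of [f]. *)
Lemma section_of_op_retraction (X Y : Db A) (f : mor X Y) :
  is_retraction (Db_op f) -> is_section f.
Proof.
move=> [s fs]; have [r [rE _]] := Db_eta_iso X.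
exists (r ∘ Db_unop s ∘ fmap (toDb A) (Cb_eta Y)).
by rewrite -!cmpmA -Db_eta_nat (cmpmA (Db_unop s)) -loc_opM fs loc_op1 cmp1m.
Qed.

Lemma finite_injective_coresolution (X Y : Db A) (f : mor X Y) :
  enough_injectives A -> left_almost_split f ->
  has_finite_injective_coresolution X.
Proof.
move=> enough [fN las].
have [||M u|P [s [P_proj qs]]] :=
  @finite_projective_resolution (op A) (Cb_op Y) (Cb_op X) (Db_op f).
- move=> I; have [J [m [Jinj mm]]] := enough I.
  by exists J, m; split=> // U V e; apply: (Jinj V U e).
- by move/section_of_op_retraction.
- pose v : mor (X : Cb A) (Cb_unop M) := unop_adjoint u.
  (* If the transpose [v] of [u] is a section, then reversing makes [u] a retraction. Otherwise [v]
     factors through [f], and the reversed factorization takes [u] through [Db_op f]. *)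
  have [[r rv]|/las [w wf]] := EM (is_section (fmap (toDb A) v)).
    left; exists (fmap (toDb (op A)) (op_unop_inv M : mor (Cb_op (Cb_unop M)) M)
      ∘ Db_op r).
    rewrite cmpmA -fmapM.
    have -> : fmap (toDb (op A)) ((u : @mor (Cb (op A)) M (Cb_op X)) ∘
        (op_unop_inv M : @mor (Cb (op A)) (Cb_op (Cb_unop M)) M))
        = Db_op (fmap (toDb A) v).
      by rewrite loc_op_mor; congr (fmap _ _); apply: unop_adjoint_inv.
    by rewrite -loc_opM rv loc_op1.
  right; exists (Db_op w ∘ fmap (toDb (op A))
    (op_unop M : @mor (Cb (op A)) M (Cb_op (Cb_unop M)))).
  have vE : Db_op (fmap (toDb A) v) = fmap (toDb (op A)) (cmap Cb_op v).
    exact: loc_op_mor.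
  rewrite cmpmA -loc_opM wf vE.
  apply: etrans (esym (@fmapM _ _ (toDb (op A)) M (Cb_op (Cb_unop M)) (Cb_op X)
    _ _)) _.
  by congr (fmap _ _); apply: op_unop_adjoint.
exists (unop_bcomplex P), (unop_adjoint s); split.
  by move=> n U V m; apply: (P_proj (- n) V U m).
exact: quasi_iso_unop_adjoint.
Qed.

End OppositeDerived.

Theorem corollary5p3 (A : abelian) (X Y Z : Db A)
    (f : mor X Y) (g : mor Y Z) (h : mor Z (Db_shift A X)) :
  almost_split_triangle f g h ->
  (enough_projectives A -> has_finite_projective_resolution Z) /\
  (enough_injectives A -> has_finite_injective_coresolution X).
Proof.
move=> [_ [_ las] [_ [gN ras]]]; split=> enough; last first.
  exact: finite_injective_coresolution enough las.
apply: (finite_projective_resolution enough gN) => Q u.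
have [|/ras] := EM (is_retraction (@fmap _ _ (toDb A) Q Z u)); first by left.
by right.
Qed.
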